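(* Let $G$ be a metabelian group with a torsion-free abelian normal subgroup $M \le G$ such that the quotient group $B = G/M$ is abelian. Suppose that the group $G$ has Krull dimension $K(G)$. Then $K(G) \le 1$ if and only if $G$ has no $\mathbb{Z}\wr\mathbb{Z}$-sections.
   Context: Deviation of a poset $\Omega$: for $a\ge b$ in $\Omega$ put $a/b=\{x\in\Omega \mid b\le x\le a\}$. If $\Omega$ is trivial (no two distinct elements are comparable), $\operatorname{dev}\Omega=-1$. If $\Omega$ is nontrivial and satisfies the minimal condition, $\operatorname{dev}\Omega=0$. For a general ordinal $\beta$, $\operatorname{dev}\Omega=\beta$ if $\operatorname{dev}\Omega\neq\alpha$ for all $\alpha<\beta$ and, in any descending chain $\{a_i\}$ of elements of $\Omega$, all but finitely many factors $a_i/a_{i+1}$ have deviation less than $\beta$. (The deviation need not exist.) The Krull dimension $K(G)$ of a group $G$ is the deviation of the poset of all normal subgroups of $G$ ordered by inclusion, if it exists. $\mathbb{Z}\wr\mathbb{Z}$ is the restricted wreath product of two infinite cyclic groups. A group has no $\mathbb{Z}\wr\mathbb{Z}$-sections if there are no subgroups $K\trianglelefteq H\le G$ with $H/K\cong\mathbb{Z}\wr\mathbb{Z}$. *)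

(* Defs.v *)
From HB Require Import structures.
From mathcomp Require Import all_boot all_order all_algebra.
From mathcomp Require Import all_classical.

Set Implicit Arguments.
Unset Strict Implicit.
Unset Printing Implicit Defensive.

Import Order.TTheory.
Local Open Scope classical_set_scope.
Local Open Scope group_scope.

(* [osup f] is the least ordinal strictly above every [f j].  Distinct trees
   may denote the same ordinal; equality of ordinals is [ole] both ways. *)
Inductive ord : Type := osup (J : Type) (f : J -> ord).

Fixpoint ole (a b : ord) : Prop :=
  let: osup J f := a in
  let: osup K g := b in
  forall j : J, exists k : K, ole (f j) (g k).

Definition olt (a b : ord) : Prop :=
  let: osup J g := b in exists j : J, ole a (g j).

Definition ozero : ord := osup (fun v : void => match v with end).
Definition oone : ord := osup (fun _ : unit => ozero).

(* An ordinal or -1, where [None] stands for -1. *)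
Definition xord : Type := option ord.

Definition xle (k l : xord) : Prop :=
  match k, l with
  | None, _ => True
  | Some _, None => False
  | Some a, Some b => ole a b
  end.

Definition xlt (k l : xord) : Prop :=
  match k, l with
  | _, None => False
  | None, Some _ => True
  | Some a, Some b => olt a b
  end.

Lemma ole_trans a b c : ole a b -> ole b c -> ole a c.
Proof.
elim: a b c => A f IH [J g] [K h] /= fg gh i.
have [j fij] := fg i; have [k gjk] := gh j.
by exists k; apply: IH gjk.
Qed.

Lemma olt_wf : well_founded olt.
Proof.
suff H a c : ole c a -> Acc olt c.
  move=> [A f]; constructor => d [i dfi]; exact: H dfi.
elim: a c => A f IH [J g] /= gf; constructor => d [j dj].
by have [i gi] := gf j; apply: (IH i); apply: ole_trans gi.
Qed.

Lemma xlt_wf : well_founded xlt.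
Proof.
have N : Acc xlt None by apply: Acc_intro; case.
move=> [a|]; last exact: N.
elim: (olt_wf a) => {}a _ IH.
by apply: Acc_intro => -[b /IH|_]; last exact: N.
Qed.

Section Deviation.
Variables (d : Order.disp_t) (T : porderType d).
Implicit Type A : set T.

(* Subsets [A] of [T] are regarded as posets for the induced order. *)

Definition trivial_poset A : Prop :=
  forall x y, A x -> A y -> (x <= y)%O -> x = y.

Definition minimal_condition A : Prop :=
  forall S : set T, S `<=` A -> S !=set0 ->
    exists2 m, S m & forall x, S x -> (x <= m)%O -> x = m.

Definition descending_chain A (a : nat -> T) : Prop :=
  (forall i, A (a i)) /\ (forall i, (a i.+1 <= a i)%O).

Definition poset_factor A (a b : T) : set T :=
  [set x | A x /\ (b <= x <= a)%O].

(* One step of the recursion on [k]; [below l X] is meant to be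
   "[l < k] and [dev X = l]", see [devE]. *)
Definition dev_step (k : xord) (below : xord -> set T -> Prop) A : Prop :=
  match k with
  | None => trivial_poset A
  | Some b =>
         [/\ ole b ozero, ~ trivial_poset A & minimal_condition A]
      \/ [/\ olt ozero b,
             forall l, ~ below l A
           & forall a, descending_chain A a ->
               cofinite_set [set i | exists l,
                 below l (poset_factor A (a i) (a i.+1))]]
  end.

(* [dev k A] means that the deviation of [A] exists and equals [k]. *)
Definition dev : xord -> set T -> Prop :=
  Fix xlt_wf (fun=> set T -> Prop)
    (fun k rec => dev_step k (fun l X => exists lk : xlt l k, rec l lk X)).

Lemma devE k A : dev k A = dev_step k (fun l X => xlt l k /\ dev l X) A.
Proof.
rewrite {1}/dev Fix_eq.
  congr (dev_step _ _ _); apply/funext => l; apply/funext => X.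
  by apply/propext; split=> [[]|[lk ?]]; last exists lk.
move=> l f g fg; congr dev_step; apply/funext => m; apply/funext => X.
by apply/propext; split=> -[ml]; [rewrite fg|rewrite -fg]; exists ml.
Qed.

End Deviation.

Section Groups.
Variable G : groupType.
Implicit Types (H K : set G) (C D : set G).

Definition subgroup H : Prop := group_closed (mem H).

Definition normal_subgroup K H : Prop :=
  [/\ subgroup K, K `<=` H & forall x h, K x -> H h -> K (x ^ h)].

Definition set_mul C D : set G := [set x * y | x in C & y in D].

Definition lcoset K (h : G) : set G := [set h * x | x in K].

(* The elements of [H / K]; its group law is [set_mul]. *)
Definition quotient H K : set (set G) := [set lcoset K h | h in H].

Definition abelian_subgroup H : Prop :=
  forall x y, H x -> H y -> x * y = y * x.

Definition abelian_quotient H K : Prop :=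
  forall C D, quotient H K C -> quotient H K D -> set_mul C D = set_mul D C.

Definition torsion_free H : Prop :=
  forall x n, H x -> (0 < n)%N -> x ^+ n = 1 -> x = 1.

Definition metabelian : Prop :=
  exists A : set G, [/\ normal_subgroup A setT, abelian_subgroup A
                      & abelian_quotient setT A].

Definition quotient_isog H K (W : groupType) : Prop :=
  exists2 f : set G -> W, set_bij (quotient H K) setT f
    & forall C D, quotient H K C -> quotient H K D ->
        f (set_mul C D) = f C * f D.

Definition has_section (W : groupType) : Prop :=
  exists H K, [/\ subgroup H, normal_subgroup K H & quotient_isog H K W].

(* [krull_dim k] means that the Krull dimension of [G] exists and equals [k];
   the order on [set G] is inclusion. *)
Definition krull_dim (k : xord) : Prop :=
  dev k [set N : set G | normal_subgroup N setT].

End Groups.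

Arguments metabelian : clear implicits.
Arguments krull_dim : clear implicits.
Arguments has_section : clear implicits.

Section Wreath.
Variables A B : groupType.

Record wreath : Type := Wreath {
  wbase : B -> A;
  wtop : B;
  wbase_finite : finite_set [set x | wbase x <> 1]
}.

HB.instance Definition _ := gen_eqMixin wreath.
HB.instance Definition _ := gen_choiceMixin wreath.

Lemma wreath_eq u v : wbase u =1 wbase v -> wtop u = wtop v -> u = v.
Proof.
case: u v => [f b pf] [g c pg] /= /funext fg bc.
by case: g / fg pg; case: c / bc => pg; rewrite (Prop_irrelevance pf pg).
Qed.

Lemma finite_translate (f : B -> A) (b : B) :
  finite_set [set x | f x <> 1] -> finite_set [set x | f (b * x) <> 1].
Proof.
move=> /(finite_image (fun x => b^-1 * x)); apply: sub_finite_set => x /= fx.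
by exists (b * x) => //; rewrite mulKg.
Qed.

Fact wreath_one_finite : finite_set [set x : B | (1 : A) <> 1].
Proof. by apply: sub_finite_set (finite_set0 _) => x /=; apply. Qed.

Fact wreath_mul_finite u v :
  finite_set [set x | wbase u x * wbase v ((wtop u)^-1 * x) <> 1].
Proof.
have fu := wbase_finite u.
have fv := finite_translate (wtop u)^-1 (wbase_finite v).
have fuv := conj fu fv; rewrite -finite_setU in fuv.
apply: sub_finite_set fuv => x /= H.
have [ux|ux] := pselect (wbase u x = 1); last by left.
by right => vx; apply: H; rewrite ux vx mulg1.
Qed.

Fact wreath_inv_finite u :
  finite_set [set x | (wbase u (wtop u * x))^-1 <> 1].
Proof.
apply: sub_finite_set (finite_translate (wtop u) (wbase_finite u)).
by move=> x /= H E; apply: H; rewrite E invg1.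
Qed.

Definition wreath_one := Wreath 1 wreath_one_finite.
Definition wreath_mul u v := Wreath (wtop u * wtop v) (wreath_mul_finite u v).
Definition wreath_inv u := Wreath (wtop u)^-1 (wreath_inv_finite u).

Fact wreath_mulA : associative wreath_mul.
Proof. by move=> u v w; apply: wreath_eq => [x|] /=; rewrite ?invgM !mulgA. Qed.

Fact wreath_mul1 : left_id wreath_one wreath_mul.
Proof. by move=> u; apply: wreath_eq => [x|] /=; rewrite ?invg1 !mul1g. Qed.

Fact wreath_mulr1 : right_id wreath_one wreath_mul.
Proof. by move=> u; apply: wreath_eq => [x|] /=; rewrite mulg1. Qed.

Fact wreath_mulV : left_inverse wreath_one wreath_inv wreath_mul.
Proof. by move=> u; apply: wreath_eq => [x|] /=; rewrite ?invgK mulVg. Qed.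

Fact wreath_mulrV : right_inverse wreath_one wreath_inv wreath_mul.
Proof. by move=> u; apply: wreath_eq => [x|] /=; rewrite ?mulVKg mulgV. Qed.

HB.instance Definition _ := isGroup.Build wreath
  wreath_mulA wreath_mul1 wreath_mulr1 wreath_mulV wreath_mulrV.

End Wreath.

Definition Z_wr_Z : groupType :=
  wreath (Algebra.to_multiplicative int) (Algebra.to_multiplicative int).

(* Main.v *)
(* As [M] and [G / M] are abelian, [M] is a module over the commutative ring [O]
   of its endomorphisms generated by conjugation.  The normal subgroups of [G]
   inside [M] are the submodules of [M]; those containing [M] are the subgroups of
   [G / M].  A [Z wr Z]-section exists iff some [h] in [G] acts transcendentally on
   some [u] in [M].

   If every element acts algebraically, then by torsion-freeness every operator
   satisfies at each element of [M] a primitive integer polynomial.  For a module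
   with this property whose lattice of submodules has a deviation, every nonzero
   interval of isolated submodules, and every nonzero torsion interval, contains an
   atom: otherwise kernels of operators would yield a descending chain whose factors
   lack atoms as well.  As infinite independent families are excluded by the
   deviation, such intervals are artinian.  So along a descending chain the isolators
   become stationary, the factors become torsion, hence artinian.  The same applies
   to [G / M] over the integers, and the two halves combine to [K(G) <= 1].

   Conversely, [G / M] has finite torsion-free rank because its deviation exists, so
   for [u] and [h] transcendental the ring [O / ann u] becomes, after inverting one
   element, integral over a polynomial ring in at least one variable over [Z].
   Such a ring has dimension at least two, whereas [K(G) <= 1] makes it
   artinian modulo every prime [q]. *)
Require Import Defs.
From HB Require Import structures.
From mathcomp Require Import all_boot all_order all_algebra.
From mathcomp Require Import all_classical.
From mathcomp Require Import ring zify.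

Set Implicit Arguments.
Unset Strict Implicit.
Unset Printing Implicit Defensive.

Import Order.TTheory.

(** * Deviation of posets *)

Lemma dependent_choice_pred (T : Type) (P : T -> Prop) (R : T -> T -> Prop) x0 :
  P x0 -> (forall x, P x -> exists2 y, P y & R x y) ->
  exists a : nat -> T, forall n, P (a n) /\ R (a n) (a n.+1).
Proof.
move=> Px0 step.
have /choice[f fP] : forall x, exists y, P x -> P y /\ R x y.
  move=> x; have [/step[y Py Rxy]|nPx] := pselect (P x); first by exists y.
  by exists x.
have aP n : P (iter n f x0) by elim: n => //= n /fP[].
by exists (fun n => iter n f x0) => n; split=> //=; apply: (fP _ (aP n)).2.
Qed.

Section Posets.
Local Open Scope classical_set_scope.

Section OnePoset.
Variables (d : Order.disp_t) (T : porderType d).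
Implicit Type A : set T.

(** Existence of a deviation without ordinals, as a well-founded tree. The start of the tail is a
    function [N] of the chain, not an existential, so that the generated induction principle reaches
    the factors. *)
Inductive has_dev : set T -> Prop :=
| HasDevTrivial A : trivial_poset A -> has_dev A
| HasDevChain A (N : (nat -> T) -> nat) :
    (forall a, descending_chain A a -> forall i, (N a <= i)%N ->
      has_dev (poset_factor A (a i) (a i.+1))) ->
    has_dev A.

Definition dcc A : Prop :=
  forall a, descending_chain A a -> exists n, a n.+1 = a n.

(** Ordinal-free form of deviation at most 1: [dcc] on a factor covers the values -1 and 0. *)
Definition dev_le1 A : Prop :=
  forall a, descending_chain A a ->
    exists n, forall i, (n <= i)%N -> dcc (poset_factor A (a i) (a i.+1)).

Lemma chain_le A a : descending_chain A a ->
  forall m n, (m <= n)%N -> (a n <= a m)%O.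
Proof.
move=> [_ ad] m n; elim: n => [|n IH]; first by rewrite leqn0 => /eqP->.
rewrite leq_eqVlt => /orP[/eqP->//|]; rewrite ltnS => /IH; exact: le_trans.
Qed.

Lemma cofinite_tail (P : nat -> Prop) :
  cofinite_set [set i | P i] <-> exists n, forall i, (n <= i)%N -> P i.
Proof.
split=> [/finite_seqP[s sE]|[n Pn]].
  exists (\max_(i <- s) i.+1) => i si; apply: contrapT => nPi.
  have : [set` s] i by rewrite -sE.
  by move=> /= /(@leq_bigmax_seq _ _ predT (fun j => j.+1)) /(_ isT); rewrite leqNgt ltnS si.
apply: (@sub_finite_set _ _ `I_n); last exact: finite_II.
by move=> i /= nP; rewrite ltnNge; apply/negP => /Pn.
Qed.

Lemma trivial_chain A a : trivial_poset A -> descending_chain A a ->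
  forall i, a i.+1 = a i.
Proof. by move=> tA [aA ad] i; apply: tA. Qed.

Lemma trivial_dcc A : trivial_poset A -> dcc A.
Proof. by move=> tA a aA; exists 0; apply: trivial_chain tA aA _. Qed.

Lemma sub_dcc A A' : A' `<=` A -> dcc A -> dcc A'.
Proof. by move=> s dA a [aA ad]; apply: dA; split=> // i; apply: s. Qed.

Lemma poset_factor_sub A x y : poset_factor A x y `<=` A.
Proof. by move=> z []. Qed.

(** [dcc] gives only one repetition per chain; a chain that never settles would have a subsequence
    whose consecutive terms all differ. *)
Lemma dcc_stable A a : dcc A -> descending_chain A a ->
  exists n, forall i, (n <= i)%N -> a i = a n.
Proof.
move=> dA aA; apply: contrapT => noN.
have step n : exists2 m, (n <= m)%N & a m <> a n.
  apply: contrapT => nm; apply: noN; exists n => i ni; apply: contrapT => ai.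
  by apply: nm; exists i.
have [|f fP] := @dependent_choice_pred nat xpredT
  (fun n m => (n <= m)%N /\ a m <> a n) 0 isT.
  by move=> n _; have [m nm am] := step n; exists m.
have [|n] := dA (a \o f); last exact: (fP n).2.2.
by split=> i /=; [apply: aA.1|apply: (chain_le aA (fP i).2.1)].
Qed.

Lemma dcc_min A : dcc A -> minimal_condition A.
Proof.
move=> dA S SA [x0 Sx0]; apply: contrapT => noM.
have [|a aP] := @dependent_choice_pred T S (fun x y => (y <= x)%O /\ y <> x) x0 Sx0.
  move=> x Sx; apply: contrapT => ny; apply: noM; exists x => // y Sy yx.
  by apply: contrapT => yNx; apply: ny; exists y.
have [|n] := dA a; last exact: (aP n).2.2.
by split=> i; [apply: SA; apply: (aP i).1|apply: (aP i).2.1].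
Qed.

Lemma min_dcc A : minimal_condition A -> dcc A.
Proof.
move=> mA a aA; have [||m [n _ <-] mP] := mA (range a).
- by move=> _ [i _ <-]; apply: aA.1.
- by exists (a 0); exists 0.
- by exists n; apply: mP; [exists n.+1|apply: aA.2].
Qed.

Lemma dcc_dev_le1 A : dcc A -> dev_le1 A.
Proof. by move=> dA a _; exists 0 => i _; apply: sub_dcc dA; apply: poset_factor_sub. Qed.

Lemma dev_None A : dev None A <-> trivial_poset A.
Proof. by rewrite devE. Qed.

Lemma dev_zero A b : ole b ozero -> dev (Some b) A ->
  ~ trivial_poset A /\ dcc A.
Proof.
rewrite devE /= => b0 [[_ nt /min_dcc]//|[]].
by case: b b0 => J f /= f0 [j _]; case: (f0 j) => -[].
Qed.

(** Induction along [xlt]. Under the minimal condition chains settle, so the later factors are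
    singletons; above 0 the later factors carry smaller deviations. *)
Lemma dev_has_dev A k : dev k A -> has_dev A.
Proof.
elim/(well_founded_ind xlt_wf): k A => -[b|] IH A; last first.
  by rewrite dev_None; exact: HasDevTrivial.
rewrite devE /= => -[[_ _ /min_dcc dA]|[_ _ cA]].
  (* [choice] needs a value for every sequence; those that are not descending chains receive 0. *)
  have {}dA a : exists n, descending_chain A a -> forall i, (n <= i)%N -> a i = a n.
    have [/(dcc_stable dA)[n an]|//] := pselect (descending_chain A a).
    - by exists n.
    - by exists 0.
  have [N NP] := choice dA; apply: (@HasDevChain _ N) => a aA i Ni.
  apply: HasDevTrivial => x y [_ /andP[]]; rewrite !(NP a aA)//; last exact: leqW.
  move=> xl xu [_ /andP[yl yu]] _.
  by rewrite (@le_anti _ _ x (a (N a))) ?xl ?xu//; apply: le_anti; rewrite yl yu.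
have {}cA a : exists n, descending_chain A a -> forall i, (n <= i)%N ->
    has_dev (poset_factor A (a i) (a i.+1)).
  have [/cA/cofinite_tail[n nP]|] := pselect (descending_chain A a); last by exists 0.
  by exists n => _ i /nP[l [lb]]; apply: IH.
by have [N NP] := choice cA; apply: (@HasDevChain _ N) => a aA i; apply: NP.
Qed.

Lemma olt_one c : olt c oone -> ole c ozero.
Proof. by case: c => J f /= [_]. Qed.

Lemma olt_trans_le a b c : olt a b -> ole b c -> olt a c.
Proof.
case: b c => J g [K h] /= [j aj] gh; have [k gk] := gh j.
by exists k; apply: ole_trans gk.
Qed.

Lemma nole_one b : ~ ole b oone -> olt oone b.
Proof.
case: b => J g /= nb; have /existsNP[j nj] : ~ forall j, ole (g j) ozero.
  by move=> g0; apply: nb => j; exists tt.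
exists j; case: (g j) nj => K h /= /existsNP[k _] _; exists k.
by case: (h k) => ? ? [].
Qed.

Lemma dev_dev_le1 A k : dev k A -> xle k (Some oone) -> dev_le1 A.
Proof.
case: k => [b|]; last by rewrite dev_None => /trivial_dcc/dcc_dev_le1.
rewrite devE /= => -[[_ _ /min_dcc/dcc_dev_le1]//|[_ _ cA] b1 a aA].
have /cofinite_tail[n nP] := cA a aA; exists n => i /nP[[c|] [/= cb dc]].
  by apply: (dev_zero _ dc).2; apply: olt_one; apply: olt_trans_le b1.
by move: dc; rewrite dev_None => /trivial_dcc.
Qed.

Lemma dcc_dev A : dcc A -> exists2 l, xlt l (Some oone) & dev l A.
Proof.
move=> dA; have [tA|nA] := pselect (trivial_poset A).
  by exists None => //; rewrite dev_None.
exists (Some ozero).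
  by exists tt; case.
rewrite devE; left; split; [by case|by []|exact: dcc_min].
Qed.

(** Under [dcc] the value is -1 or 0. Otherwise it is exactly 1, because each smaller value would
    imply [dcc]. *)
Lemma dev_le1_dev A : dev_le1 A -> exists2 l, xle l (Some oone) & dev l A.
Proof.
move=> dA; have [cA|nA] := pselect (dcc A).
  have [[l|//] ll dl] := dcc_dev cA; last by exists None.
  exists (Some l) => //; move: (olt_one ll).
  by case: l {ll dl} => J f /= h j; have [] := h j.
exists (Some oone).
  by move=> j; exists j; case.
rewrite devE /=; right; split; first by (exists tt; case).
  move=> [c [/= /olt_one c0 /(dev_zero c0)[]//]|[_]].
  by rewrite dev_None => /trivial_dcc.
move=> a /dA[n nP]; apply/cofinite_tail; exists n => i /nP/dcc_dev[l ll dl].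
by exists l.
Qed.

(** A value above 1 excludes by definition all smaller deviations, among them the one supplied by
    [dev_le1_dev]. *)
Lemma dev_le1_xle A k : dev k A -> dev_le1 A -> xle k (Some oone).
Proof.
case: k => [b|//] dk /dev_le1_dev[l l1 dl]; apply: contrapT => /nole_one b1.
move: dk; rewrite devE /= => -[[b0 _ _]|[_ nl _]].
  have := olt_trans_le b1 b0; case=> -[].
apply: (nl l); split=> //; case: l l1 {dl nl} => //= c c1.
case: b b1 => J g /= [j cj]; exists j; apply: ole_trans c1 cj.
Qed.

End OnePoset.

(** * Transport of deviation conditions along strictly monotone maps *)

Section Embedding.
Variables (d d' : Order.disp_t) (T : porderType d) (T' : porderType d').

(** Injectivity on comparable pairs is all that chains and their factors require. *)
Definition strict_mono (A' : set T') (f : T' -> T) : Prop :=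
  forall x y, A' x -> A' y -> (x <= y)%O -> (f x <= f y)%O /\ (f x = f y -> x = y).

Variables (A : set T) (A' : set T') (f : T' -> T).
Hypotheses (fA : forall x, A' x -> A (f x)) (fmono : strict_mono A' f).

Lemma chain_embed a : descending_chain A' a -> descending_chain A (f \o a).
Proof.
by move=> [aA ad]; split=> i /=; [apply: fA|have [] := fmono (aA i.+1) (aA i) (ad i)].
Qed.

Lemma factor_embed a : descending_chain A' a -> forall i x,
  poset_factor A' (a i) (a i.+1) x ->
  poset_factor A ((f \o a) i) ((f \o a) i.+1) (f x).
Proof.
move=> [aA ad] i x [Ax /andP[l u]]; split; first exact: fA.
by rewrite (fmono (aA _) Ax l).1 (fmono Ax (aA _) u).1.
Qed.

Lemma dcc_embed : dcc A -> dcc A'.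
Proof.
move=> dA a aA; have [n] := dA _ (chain_embed aA); exists n.
by apply: (fmono (aA.1 _) (aA.1 _) (aA.2 _)).2.
Qed.
End Embedding.

Section EmbeddingDev.
Variables (d d' : Order.disp_t) (T : porderType d) (T' : porderType d').

Lemma sub_strict_mono (A' B : set T') (f : T' -> T) : B `<=` A' -> strict_mono A' f -> strict_mono B f.
Proof. by move=> s fm x y /s ? /s ?; apply: fm. Qed.

Lemma has_dev_embed (A : set T) (A' : set T') (f : T' -> T) : (forall x, A' x -> A (f x)) -> strict_mono A' f ->
  has_dev A -> has_dev A'.
Proof.
move=> fA fm dA; elim: dA A' fA fm => {}A => [tA|N _ IH] A' fA fm.
  by apply: HasDevTrivial => x y Ax Ay xy; apply: (fm _ _ Ax Ay xy).2;
    apply: tA; rewrite ?(fm _ _ Ax Ay xy).1; auto.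
apply: (@HasDevChain _ _ _ (fun a => N (f \o a))) => a aA i Ni.
apply: IH (chain_embed fA fm aA) _ Ni _ _ _.
  exact: (factor_embed fA fm aA).
by apply: sub_strict_mono fm; apply: poset_factor_sub.
Qed.

Lemma dev_le1_embed (A : set T) (A' : set T') (f : T' -> T) : (forall x, A' x -> A (f x)) -> strict_mono A' f ->
  dev_le1 A -> dev_le1 A'.
Proof.
move=> fA fm dA a aA; have [n nP] := dA _ (chain_embed fA fm aA).
exists n => i /nP; apply: dcc_embed (@factor_embed _ _ _ _ _ _ _ fA fm _ aA i) _.
by apply: sub_strict_mono fm; apply: poset_factor_sub.
Qed.
End EmbeddingDev.

(* The subsets of [nat * nat] containing every pair with first component [> i]
   and contained in those with first component [>= i] form a copy of the power
   set of [nat], and these intervals are stacked in a descending chain. *)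
Lemma has_dev_no_powerset (d : Order.disp_t) (T : porderType d) (A : set T)
  (f : set nat -> T) :
  (forall I, A (f I)) -> strict_mono [set: set nat] f -> has_dev A -> False.
Proof.
move=> fA fm dA; elim: dA f fA fm => {}A => [tA|N _ IH] f fA fm.
  have s01 : (set0 <= [set: nat])%O by apply/subsetPset.
  have [le01 /(_ (tA _ _ (fA _) (fA _) le01)) E] := fm set0 setT I I s01.
  by have : @set0 nat 0 by rewrite E.
pose c i : set nat := [set n | exists a b : nat, n = pickle (a, b) /\ (i <= a)%N].
pose g i (X : set nat) : set nat := c i.+1 `|` [set pickle (i, b) | b in X].
have cd i : c i.+1 `<=` c i.
  by move=> _ [a [b [-> ia]]]; exists a, b; split=> //; apply: ltnW.
have gc i X : g i X `<=` c i.
  by move=> n [/cd//|[b _ <-]]; exists i, b.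
have aA : descending_chain A (fun i => f (c i)).
  by split=> // i; apply: (fm _ _ _ _ _).1 => //; apply/subsetPset.
apply: (IH _ aA _ (leqnn _) (fun X => f (g (N (fun i => f (c i))) X))).
  move=> X; split=> //; apply/andP; split; apply: (fm _ _ _ _ _).1 => //;
  by apply/subsetPset => // n cn; left.
move=> X Y _ _ /subsetPset XY; set i := N _.
have gXY : (g i X <= g i Y)%O.
  by apply/subsetPset => n [?|[b Xb <-]]; [left|right; exists b => //; apply: XY].
have [fle feq] := fm _ _ I I gXY; split=> // /feq gE.
apply/seteqP; split=> // b Yb.
(* A pair with first component [i] is not in [c i.+1], so it must come from [X]. *)
have : g i X (pickle (i, b)) by rewrite gE; right; exists b.
case=> [[a [b' [/(pcan_inj pickleK) [-> _]]]]|[b' Xb' /(pcan_inj pickleK) [<-]//]].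
by rewrite ltnn.
Qed.

End Posets.

(** * Modules whose lattice of submodules has a deviation *)

Section Modules.
Import GRing.Theory Num.Theory.
Local Open Scope classical_set_scope.
Local Open Scope ring_scope.
Variables (R : comNzRingType) (V : lmodType R).
Implicit Types (X Y N D E : set V) (r : R) (x v : V) (n : int).

Definition submodule X : Prop :=
  [/\ X 0, forall x y, X x -> X y -> X (x + y) & forall r x, X x -> X (r *: x)].

Definition submodules : set (set V) := [set X | submodule X].

Lemma submodule0 X : submodule X -> X 0. Proof. by case. Qed.
Lemma submoduleD X x y : submodule X -> X x -> X y -> X (x + y).
Proof. by case=> _ + _; apply. Qed.
Lemma submoduleZ X r x : submodule X -> X x -> X (r *: x).
Proof. by case=> _ _; apply. Qed.
Lemma submoduleN X x : submodule X -> X x -> X (- x).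
Proof. by move=> Xs Xx; rewrite -scaleN1r; apply: submoduleZ. Qed.
Lemma submoduleB X x y : submodule X -> X x -> X y -> X (x - y).
Proof. by move=> Xs Xx Xy; apply: submoduleD => //; apply: submoduleN. Qed.
Lemma submodule_sum X m (y : nat -> V) : submodule X -> (forall i, (i < m)%N -> X (y i)) ->
  X (\sum_(i < m) y i).
Proof.
move=> Xs Xy; apply: (big_ind X) => [|x z|i _]; [exact: submodule0|exact: submoduleD|exact: Xy].
Qed.

Definition sum_set X Y : set V := [set x + y | x in X & y in Y].

Lemma submodule_sum_set X Y : submodule X -> submodule Y -> submodule (sum_set X Y).
Proof.
move=> [X0 XD XZ] [Y0 YD YZ]; split.
- by exists 0 => //; exists 0 => //; rewrite addr0.
- move=> _ _ [x Xx [y Yy <-]] [x' Xx' [y' Yy' <-]].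
  by exists (x + x'); [exact: XD|exists (y + y'); [exact: YD|rewrite addrACA]].
- move=> r _ [x Xx [y Yy <-]]; exists (r *: x); first exact: XZ.
  by exists (r *: y); [exact: YZ|rewrite scalerDr].
Qed.

Lemma sum_setl X Y : submodule Y -> X `<=` sum_set X Y.
Proof. by move=> Ys x Xx; exists x => //; exists 0; [exact: submodule0|rewrite addr0]. Qed.
Lemma sum_setr X Y : submodule X -> Y `<=` sum_set X Y.
Proof. by move=> Xs x Xx; exists 0; [exact: submodule0|exists x => //; rewrite add0r]. Qed.
Lemma sum_set_sub X Y N : submodule N -> X `<=` N -> Y `<=` N -> sum_set X Y `<=` N.
Proof. by move=> Ns XN YN _ [x /XN Nx [y /YN Ny <-]]; apply: submoduleD. Qed.

Definition cyclic v : set V := range (fun r => r *: v).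

Lemma submodule_cyclic v : submodule (cyclic v).
Proof.
split; first by exists 0; rewrite ?scale0r.
- by move=> _ _ [r _ <-] [s _ <-]; exists (r + s); rewrite ?scalerDl.
- by move=> r _ [s _ <-]; exists (r * s); rewrite ?scalerA.
Qed.

Lemma cyclic_id v : cyclic v v. Proof. by exists 1; rewrite ?scale1r. Qed.

Definition scaled r X : set V := [set r *: x | x in X].

Lemma submodule_scaled r X : submodule X -> submodule (scaled r X).
Proof.
move=> [X0 XD XZ]; split; first by exists 0; rewrite ?scaler0.
- by move=> _ _ [x Xx <-] [y Xy <-]; exists (x + y); [exact: XD|rewrite scalerDr].
- move=> s _ [x Xx <-]; exists (s *: x); first exact: XZ.
  by rewrite !scalerA mulrC.
Qed.

Definition interval (C : set (set V)) N D : set (set V) :=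
  [set X | [/\ C X, N `<=` X & X `<=` D]].

Definition strictly_below N D : Prop := N `<=` D /\ exists2 x, D x & ~ N x.

Definition atom_over (C : set (set V)) N E : Prop :=
  [/\ C E, strictly_below N E
    & forall X, C X -> strictly_below N X -> X `<=` E -> E `<=` X].

Lemma factor_interval (C : set (set V)) (a : nat -> set V) N D i :
  descending_chain (interval C N D) a ->
  poset_factor (interval C N D) (a i) (a i.+1) = interval C (a i.+1) (a i).
Proof.
move=> [aA _]; apply/seteqP; split=> X.
  by move=> [[CX _ _] /andP[/subsetPset ? /subsetPset ?]].
move=> [CX l u]; have [_ Na _] := aA i.+1; have [_ _ aD] := aA i.
split; last by apply/andP; split; apply/subsetPset.
by split=> // x; [move/Na/l|move/u/aD].
Qed.

(** * Existence of atoms among saturated submodules *)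

Section Saturated.
Variables (S : set int) (Z : set V).
Hypotheses (S1 : S 1) (SM : forall m n, S m -> S n -> S (m * n)).
Hypothesis Z_sub : submodule Z.
Hypothesis S_algebraic : forall r v, exists p : {poly int},
  (exists i, S p`_i) /\ (map_poly intr p).[r] *: v = 0.

(** Covers two cases at once: isolated submodules, with [S] the nonzero integers and [Z] everything;
    and [S] the integers prime to a prime [q], with [Z] killed by [q] modulo a smaller submodule,
    where every submodule in between is saturated. *)
Definition saturated X : Prop :=
  submodule X /\ forall n x, S n -> Z x -> X (n%:~R *: x) -> X x.

Definition saturation X : set V := [set x | Z x /\ exists2 n, S n & X (n%:~R *: x)].

Lemma saturated_saturation X : submodule X -> saturated (saturation X).
Proof.
move=> Xs; split; first split.
- split; first exact: submodule0.
  by exists 1 => //; rewrite scaler0; apply: submodule0.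
- move=> x y [Zx [m Sm Xx]] [Zy [n Sn Xy]]; split; first exact: submoduleD.
  exists (m * n); first exact: SM.
  rewrite scalerDr rmorphM /= -scalerA.
  apply: submoduleD => //; last by rewrite -scalerA; apply: submoduleZ.
  by rewrite scalerA mulrC -scalerA; apply: submoduleZ.
- move=> r x [Zx [m Sm Xx]]; split; first exact: submoduleZ.
  by exists m => //; rewrite scalerA mulrC -scalerA; apply: submoduleZ.
- move=> n x Sn Zx [_ [m Sm Xx]]; split=> //; exists (m * n); first exact: SM.
  by rewrite rmorphM /= -scalerA.
Qed.

Lemma sub_saturation X : X `<=` Z -> X `<=` saturation X.
Proof. by move=> XZ x Xx; split; [exact: XZ|exists 1 => //; rewrite scale1r]. Qed.

Lemma saturation_sub X Y : saturated Y -> X `<=` Y -> saturation X `<=` Y.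
Proof. by move=> [_ Ys] XY x [Zx [n Sn /XY]]; apply: Ys. Qed.

(* A polynomial relation satisfied by [r] at [d] can be divided by [r] until
   its constant term lies in [S]. *)
Lemma divide_relation N D r d (p : {poly int}) : submodule N -> submodule D -> D d ->
  (forall n x, ~ S n -> D x -> N (n%:~R *: x)) ->
  (forall z, D z -> N (r *: z) -> N z) ->
  (exists i, S p`_i) -> N ((map_poly intr p).[r] *: d) ->
  exists2 n, S n & exists2 s, N s & exists b, n%:~R *: d = b *: (r *: d) + s.
Proof.
move=> Ns Ds Dd NS inj; elim/poly_ind: p => [[i Si]|q c IH [i Si]].
  move: Si; rewrite coef0 => S0 _; exists 0 => //; exists 0; first exact: submodule0.
  by exists 0; rewrite !scale0r addr0.
rewrite rmorphD rmorphM /= map_polyX map_polyC /= !hornerE scalerDl mulrC -scalerA => Nqc.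
have [Sc|nSc] := pselect (S c).
  exists c => //; exists (r *: ((map_poly intr q).[r] *: d) + c%:~R *: d) => //.
  by exists (- (map_poly intr q).[r]); rewrite scaleNr !scalerA (mulrC r) addKr.
apply: IH.
  case: i Si => [|i]; rewrite coefD coefC coefMX /=; first by rewrite add0r.
  by rewrite addr0; exists i.
(* As [c] lies outside [S], it kills [d] modulo [N]; what remains of the relation is a multiple of
   [r], which injectivity cancels. *)
apply: inj; first exact: submoduleZ.
by rewrite -[_ *: _](addrK (c%:~R *: d)); apply: submoduleB => //; apply: NS.
Qed.

(** Induction on the deviation of the interval. If no atom lies over [N] inside [D], kernels of
    operators modulo [N] form a descending chain from [D] in which no later member has an atom over
    it inside its predecessor. The induction hypothesis for a factor far down the chain provides
    such an atom. *)
Lemma exists_atom N D : saturated N -> saturated D -> D `<=` Z -> strictly_below N D ->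
  (forall n x, ~ S n -> D x -> N (n%:~R *: x)) ->
  has_dev (interval saturated N D) -> exists2 E, atom_over saturated N E & E `<=` D.
Proof.
move=> Nsat Dsat DZ ND NS hd; set A := interval _ _ _ in hd.
have [B BE] : exists B, B = A by exists A.
rewrite -BE in hd; move: BE; rewrite /A {A} => BE.
elim: hd N D Nsat Dsat DZ ND NS BE => {}B => [tB|f _ IH] N D Nsat Dsat DZ ND NS BE.
  have ND' : N = D.
    apply: tB; rewrite ?BE; [by split=> //; apply: ND.1|by split=> //; apply: ND.1|].
    by apply/subsetPset; apply: ND.1.
  by case: ND => _ [x]; rewrite ND'.
apply: contrapT => noatom.
pose good K := [/\ saturated K, strictly_below N K & K `<=` D].
have step D' : good D' -> exists2 K, good K & strictly_below K D' /\
    ~ exists2 E, atom_over saturated K E & E `<=` D'.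
  move=> [D'sat [ND' [d D'd nNd]] D'D].
  have D's := D'sat.1; have Ns := Nsat.1.
  have D'Z : D' `<=` Z by move=> x /D'D/DZ.
  pose C := saturation (sum_set (cyclic d) N).
  have Csat : saturated C.
    by apply: saturated_saturation; apply: submodule_sum_set => //; apply: submodule_cyclic.
  have sCD' : sum_set (cyclic d) N `<=` D'.
    by apply: sum_set_sub => // _ [r _ <-]; apply: submoduleZ.
  have sC : sum_set (cyclic d) N `<=` C by apply: sub_saturation => x /sCD'/D'Z.
  have CD' : C `<=` D' by apply: saturation_sub.
  have NC : N `<=` C by move=> x Nx; apply/sC/sum_setr => //; apply: submodule_cyclic.
  have Cd : C d by apply/sC/sum_setl => //; apply: cyclic_id.
  (* [C] is not an atom, and a saturated submodule over [N] that contains [d] contains all of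
     [C]. *)
  have [X [Xsat NX XC nXd]] : exists X, [/\ saturated X, strictly_below N X, X `<=` C & ~ X d].
    apply: contrapT => noX; apply: noatom; exists C; last by move=> x /CD'/D'D.
    split=> //; first by split=> //; exists d.
    move=> X Xsat NX XC; have [Xd|nXd] := pselect (X d).
      apply: saturation_sub => //; apply: sum_set_sub => //; [exact: Xsat.1| |exact: NX.1].
      by move=> _ [r _ <-]; apply: submoduleZ => //; exact: Xsat.1.
    by exfalso; apply: noX; exists X.
  have [r Xrd nNrd] : exists2 r, X (r *: d) & ~ N (r *: d).
    case: NX => NX [x Xx nNx]; have [_ [n Sn [_ [r _ <-] [v Nv xE]]]] := XC _ Xx.
    have rdE : r *: d = n%:~R *: x - v by rewrite -xE addrK.
    exists r; rewrite rdE.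
      by apply: submoduleB; [exact: Xsat.1|apply: submoduleZ => //; exact: Xsat.1|exact: NX].
    move=> Nxv; apply: nNx; apply: (Nsat.2 n) => //; first exact/D'Z/CD'/XC.
    by rewrite -[_ *: _](subrK v); apply: submoduleD.
  (* The kernel of [r] on [D'] modulo [N]; it omits [d], so it is strictly below [D']. *)
  pose K : set V := [set z | D' z /\ N (r *: z)].
  have Ksat : saturated K.
    split; first split.
    - by split; [exact: submodule0|rewrite scaler0; exact: submodule0].
    - move=> x y [? ?] [? ?]; split; first exact: submoduleD.
      by rewrite scalerDr; apply: submoduleD.
    - move=> s x [? ?]; split; first exact: submoduleZ.
      by rewrite scalerA mulrC -scalerA; apply: submoduleZ.
    move=> n x Sn Zx [D'nx Nnx]; split; first exact: (D'sat.2 n).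
    apply: (Nsat.2 n) => //; first exact: submoduleZ.
    by rewrite scalerA mulrC -scalerA.
  have NK : N `<=` K by move=> x Nx; split; [exact: ND'|exact: submoduleZ].
  (* If the kernel were [N], [divide_relation] would put an [S]-multiple of [d] into [X], hence [d]
     itself by saturation. *)
  have [z D'z [Nrz nNz]] : exists2 z, D' z & N (r *: z) /\ ~ N z.
    apply: contrapT => noz; apply: nXd.
    have inj z : D' z -> N (r *: z) -> N z.
      by move=> D'z Nrz; apply: contrapT => nNz; apply: noz; exists z.
    have [p [Sp p0]] := S_algebraic r d.
    have [||n Sn [s Ns' [b nE]]] := @divide_relation N D' r d p Ns D's D'd _ inj Sp.
    - by move=> n x nSn /D'D; apply: NS.
    - by rewrite p0; apply: submodule0.
    apply: (Xsat.2 n) => //; first exact: D'Z.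
    rewrite nE; apply: submoduleD; [exact: Xsat.1| |exact: NX.1].
    by apply: submoduleZ => //; exact: Xsat.1.
  exists K.
    split=> //; last by move=> x [/D'D].
    by split=> //; exists z.
  split; first by split; [move=> x []|exists d => // -[]].
  (* Multiplication by [r] carries an atom [E] over the kernel to an atom over [N], after
     saturation: a smaller [Y] pulls back to a saturated submodule of [E] strictly over the
     kernel. *)
  move=> [E [Esat [KE [e Ee nKe]] Emin] ED']; apply: noatom.
  have Es := Esat.1.
  pose F := saturation (sum_set (scaled r E) N).
  have sFs : submodule (sum_set (scaled r E) N).
    by apply: submodule_sum_set => //; apply: submodule_scaled.
  have Fsat : saturated F by apply: saturated_saturation.
  have sFD' : sum_set (scaled r E) N `<=` D'.
    by apply: sum_set_sub => // _ [x /ED' D'x <-]; apply: submoduleZ.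
  have sF : sum_set (scaled r E) N `<=` F by apply: sub_saturation => x /sFD'/D'Z.
  have FD' : F `<=` D' by apply: saturation_sub.
  exists F; last by move=> x /FD'/D'D.
  split=> //.
    split; first by move=> x Nx; apply/sF/sum_setr => //; apply: submodule_scaled.
    exists (r *: e); first by apply/sF/sum_setl => //; exists e.
    by move=> Nre; apply: nKe; split=> //; apply: ED'.
  move=> Y Ysat [NY [y Yy nNy]] YF; have Ys := Ysat.1.
  suff EY : E `<=` [set x | E x /\ Y (r *: x)].
    apply: saturation_sub => //; apply: sum_set_sub => //.
    by move=> _ [x /EY[_ Yrx] <-].
  apply: Emin; last by move=> x [].
    split; first split.
    - by split; [exact: submodule0|rewrite scaler0; exact: submodule0].
    - move=> u v [? ?] [? ?]; split; first exact: submoduleD.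
      by rewrite scalerDr; apply: submoduleD.
    - move=> s u [? ?]; split; first exact: submoduleZ.
      by rewrite scalerA mulrC -scalerA; apply: submoduleZ.
    move=> n u Sn Zu [Enu Ynu]; have Eu : E u by apply: (Esat.2 n).
    split=> //; apply: (Ysat.2 n) => //; first exact: submoduleZ.
    by rewrite scalerA mulrC -scalerA.
  split; first by move=> x Kx; split; [exact: KE|apply: NY; case: Kx].
  have [Zy [n Sn [_ [x Ex <-] [v Nv xE]]]] := YF _ Yy.
  have rxE : r *: x = n%:~R *: y - v by rewrite -xE addrK.
  exists x.
    by split=> //; rewrite rxE; apply: submoduleB => //; [exact: submoduleZ|exact: NY].
  move=> [_ Nrx]; apply: nNy; apply: (Nsat.2 n) => //.
  by rewrite -xE; apply: submoduleD.
have [|a aP] := @dependent_choice_pred _ good (fun D' K => strictly_below K D' /\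
    ~ exists2 E, atom_over saturated K E & E `<=` D') D _ step; first by split.
have aB : descending_chain B a.
  split=> i; last by apply/subsetPset; exact: (aP i).2.1.1.
  by have [[? [? _] ?] _] := aP i; rewrite BE.
have [[[a1sat Na1 _] _] [[asat Na aD] [a1a noa]]] := (aP (f a).+1, aP (f a)).
apply: noa; apply: (IH a aB (f a) (leqnn _)) => //.
- by move=> x /aD/DZ.
- by move=> n x nSn /aD /(NS _ _ nSn); apply: Na1.1.
- by rewrite BE factor_interval // -BE.
Qed.
End Saturated.

(** Modulo [N] the [a i] form a direct sum of nonzero submodules, so assigning to a set of indices
    the sum of its terms embeds the power set of [nat]. *)
Lemma no_independent_family N (a : nat -> set V) : submodule N ->
  (forall i, submodule (a i)) -> (forall i, exists2 x, a i x & ~ N x) ->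
  (forall m y, (forall i, a i (y i)) -> N (\sum_(i < m.+1) y i) -> N (y m)) ->
  ~ has_dev submodules.
Proof.
move=> Ns as_ aN ind.
have indall m y : (forall i, a i (y i)) -> N (\sum_(i < m) y i) ->
    forall i, (i < m)%N -> N (y i).
  move=> ya; elim: m => [//|m IH] Nsum i; have Nm := ind _ _ ya Nsum.
  rewrite ltnS leq_eqVlt => /orP[/eqP->//|]; apply: IH.
  by move: Nsum; rewrite big_ord_recr /= => /submoduleB/(_ Nm); rewrite addrK; apply.
pose f (I : set nat) : set V := [set x | exists m (y : nat -> V),
  [/\ forall i, a i (y i), forall i, ~ I i -> y i = 0 & N (x - \sum_(i < m) y i)]].
have extend m m' (y : nat -> V) : (m <= m')%N ->
    \sum_(i < m) y i = \sum_(i < m') (if (i < m)%N then y i else 0).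
  by move=> mm'; rewrite (big_ord_widen _ y mm') big_mkcond.
apply: (@has_dev_no_powerset _ _ _ f).
  move=> I; split.
  - exists 0, (fun=> 0); split=> //; first by move=> i; apply: submodule0.
    by rewrite big_ord0 subr0; apply: submodule0.
  - move=> x x' [m [y [ya yI Nx]]] [m' [y' [ya' yI' Nx']]].
    exists (maxn m m'), (fun i => (if (i < m)%N then y i else 0) + (if (i < m')%N then y' i else 0)).
    split=> [i|i nI|].
    + by apply: submoduleD => //; case: ifP => // _; apply: submodule0.
    + by rewrite yI // yI' // !if_same addr0.
    + rewrite big_split /= -extend ?leq_maxl// -extend ?leq_maxr//.
      by rewrite opprD addrACA; apply: submoduleD.
  - move=> r x [m [y [ya yI Nx]]]; exists m, (fun i => r *: y i); split=> [i|i nI|].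
    + exact: submoduleZ.
    + by rewrite yI ?scaler0.
    + by rewrite -scaler_sumr -scalerBr; apply: submoduleZ.
move=> I J _ _ /subsetPset IJ; split.
  apply/subsetPset => x [m [y [ya yI Nx]]]; exists m, y; split=> // i nJ.
  by apply: yI => /IJ.
move=> fE; apply/seteqP; split=> // n Jn; apply: contrapT => nIn.
have [x anx nNx] := aN n; apply: nNx.
have [m [y [ya yI Nx]]] : f I x.
  rewrite fE; exists n.+1, (fun i => if i == n then x else 0); split=> [i|i nJi|].
  - by case: eqP => [->//|_]; apply: submodule0.
  - by case: eqP => // iE; rewrite iE in nJi.
  - rewrite big_ord_recr /= eqxx big1 ?add0r ?subrr; first exact: submodule0.
    by move=> i _; rewrite ltn_eqF.
(* The difference of two expressions for [x] modulo [N]; its entry at [n] is [- x], because [y n]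
   vanishes for [n] outside [I]. *)
pose z i := (if (i < m)%N then y i else 0) - (if i == n then x else 0).
have za i : a i (z i).
  apply: submoduleB => //; first by case: ifP => // _; apply: submodule0.
  by case: eqP => [->//|_]; apply: submodule0.
have nm : (n < maxn m n.+1)%N by rewrite leq_max leqnn orbT.
have Nz : N (\sum_(i < maxn m n.+1) z i).
  rewrite sumrB -extend ?leq_maxl// -opprB.
  rewrite (_ : \sum_(i < _) (if _ == n then _ else _) = x); first exact: submoduleN.
  rewrite (bigD1 (Ordinal nm)) //= eqxx big1 ?addr0 // => i.
  by rewrite -val_eqE /= => /negbTE->.
have := indall _ _ za Nz _ nm; rewrite /z eqxx yI // if_same sub0r => /(submoduleN Ns).
by rewrite opprK.
Qed.

(** * From atoms to the descending chain condition *)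

Section Atomic.
Variable C : set (set V).
Hypothesis C_sub : forall X, C X -> submodule X.
Hypothesis C_cap : forall F : nat -> set V, (forall i, C (F i)) -> C (\bigcap_i F i).

Lemma closedI X Y : C X -> C Y -> C (X `&` Y).
Proof.
move=> CX CY; have -> : X `&` Y = \bigcap_i (if i == 0%N then X else Y).
  apply/seteqP; split=> x; first by move=> [Xx Yx] [|i] _.
  by move=> H; split; [exact: (H 0)|exact: (H 1)].
by apply: C_cap => -[|i].
Qed.

(* If a descending chain does not become stationary, atoms over its
   intersection taken further and further down the chain are independent. *)
Lemma dcc_of_atoms N D : has_dev submodules ->
  (forall N' D', C N' -> C D' -> N `<=` N' -> D' `<=` D -> strictly_below N' D' ->
    exists2 E, atom_over C N' E & E `<=` D') ->
  dcc (interval C N D).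
Proof.
move=> hd AT a aA; apply: contrapT => /forallNP nst.
pose I := \bigcap_i a i.
have aI i : C (a i) /\ N `<=` a i /\ a i `<=` D by have [] := aA.1 i.
have as_ i := C_sub (aI i).1.
have CI : C I by apply: C_cap => i; apply: (aI i).1.
have Is := C_sub CI.
have Ia i : I `<=` a i by move=> x; apply.
have Ilt i : strictly_below I (a i).
  split=> //; apply: contrapT => no; apply: (nst i); apply/seteqP; split.
    by apply/subsetPset; apply: aA.2.
  move=> x ax; apply: contrapT => nx; apply: no; exists x => // Ix.
  by apply: nx; apply: Ia.
(* A state holds the sum of the atoms so far, the last atom, and an index from which the chain meets
   that sum only in [I]. *)
pose good (s : set V * set V * nat) := submodule s.1.1 /\ s.1.1 `&` a s.2 `<=` I.
pose next (s s' : set V * set V * nat) :=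
  [/\ submodule s'.1.2, s'.1.2 `<=` a s.2, exists2 x, s'.1.2 x & ~ I x
    & s'.1.1 = sum_set s.1.1 s'.1.2].
have [||s sP] := @dependent_choice_pred _ good next (I, I, 0).
- by split=> // x [].
- move=> [[T ?] j] [/= Ts TI].
  have [|||E [CE [IE [x Ex nIx]] Emin] Ea] := AT I (a j) CI (aI j).1.
  + by move=> x Nx i _; apply: (aI i).2.1.
  + exact: (aI j).2.2.
  + exact: Ilt.
  have [k nak] : exists k, ~ a k x by apply/existsNP => ax; apply: nIx => i _; apply: ax.
  (* Otherwise minimality of the atom [E] would force it into [a k], which misses [x]. *)
  have EkI : E `&` a k `<=` I.
    move=> z Ez; apply: contrapT => nIz; apply: nak.
    have /(_ _ Ex)[]// : E `<=` E `&` a k.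
    apply: Emin; [exact: closedI (aI k).1| |exact: subIsetl].
    by split; [move=> u Iu; split; [exact: IE|exact: Ia]|exists z].
  exists (sum_set T E, E, maxn j k).
    split=> /=; first by apply: submodule_sum_set => //; apply: C_sub.
    move=> _ [[t Tt [e Ee <-]] ate].
    have atej : a j (t + e).
      by have /subsetPset := chain_le aA (leq_maxl j k); apply.
    have It : I t by apply: TI; split=> //; rewrite -(addrK e t); apply: submoduleB; auto.
    apply: EkI; split; first by apply: submoduleD (IE _ It) Ee; apply: C_sub.
    by have /subsetPset := chain_le aA (leq_maxr j k); apply.
  by split=> //=; [exact: C_sub|exists x].
apply: (@no_independent_family I (fun i => (s i.+1).1.2)) hd => //.
- by move=> i; have [_ []] := sP i.
- by move=> i; have [_ []] := sP i.
move=> m y ya; rewrite big_ord_recr /= => Iy.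
have Ts : forall k, (s k).1.1 (\sum_(i < k) y i).
  elim=> [|k IH]; first by rewrite big_ord0; apply: submodule0; apply: (sP 0).1.1.
  by have [_ [_ _ _ ->]] := sP k; rewrite big_ord_recr; exists (\sum_(i < k) y i) => //; exists (y k).
have aym : a (s m).2 (y m) by have [_ [_ H _ _]] := sP m; apply: H.
have : I (\sum_(i < m) y i).
  apply: (sP m).1.2; split=> //.
  by rewrite -[X in a _ X](addrK (y m)); apply: submoduleB => //; apply: Ia.
by move=> /(submoduleB Is Iy); rewrite addrAC subrr add0r.
Qed.
End Atomic.

Definition span_seq (s : seq V) : set V :=
  [set x | forall X, submodule X -> {in s, forall y, X y} -> X x].

Lemma submodule_span s : submodule (span_seq s).
Proof.
split=> [X Xs _|x y sx sy X Xs sX|r x sx X Xs sX].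
- exact: submodule0.
- by apply: submoduleD; [|exact: sx|exact: sy].
- by apply: submoduleZ; [|exact: sx].
Qed.

(** Otherwise generators can be chosen greedily, each spanning a nonzero cyclic submodule that meets
    the span of the earlier ones in 0; the resulting family is independent. *)
Lemma finite_rank : has_dev submodules ->
  exists s, forall v, v <> 0 -> exists2 r, r *: v <> 0 & span_seq s (r *: v).
Proof.
move=> hd; apply: contrapT => /forallNP no.
have step s : exists v, v <> 0 /\ forall r, span_seq s (r *: v) -> r *: v = 0.
  have /existsNP[v /not_implyP[v0 nv]] := no s; exists v; split=> // r sr.
  by apply: contrapT => rv; apply: nv; exists r.
have [f fP] := choice step.
pose s (k : nat) := iter k (fun t => f t :: t) [::].
have sub_s k m : (k < m)%N -> f (s k) \in s m.
  elim: m => [//|m IH]; rewrite ltnS leq_eqVlt in_cons => /orP[/eqP->|/IH->].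
    by rewrite eqxx.
  by rewrite orbT.
apply: (@no_independent_family [set 0] (fun i => cyclic (f (s i)))) hd.
- split=> // [x y -> ->|r x ->]; first by rewrite addr0.
  by rewrite scaler0.
- by move=> i; apply: submodule_cyclic.
- by move=> i; exists (f (s i)); [exact: cyclic_id|exact: (fP _).1].
move=> m y ya; rewrite big_ord_recr /= => /eqP; rewrite addrC addr_eq0 => /eqP ym.
have [r _ rE] := ya m; rewrite -rE /=; apply: (fP _).2; rewrite rE ym.
have sp := submodule_span (s m).
apply: (submoduleN sp); apply: (submodule_sum sp) => i im.
have [r' _ <-] := ya i; apply: (submoduleZ _ sp) => X _; apply; exact: sub_s.
Qed.

(** Primitivity serves both uses of [exists_atom]: the relations are nonzero, which handles isolated
    submodules, and stay nonzero modulo each prime [q], which handles the [q]-torsion of a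
    factor. *)
Lemma dev_le1_submodules :
  (forall r v, exists p : {poly int},
    (forall q : nat, prime q -> exists i, ~~ (q %| p`_i)%Z) /\
    (map_poly intr p).[r] *: v = 0) ->
  has_dev submodules -> dev_le1 submodules.
Proof.
move=> prim hd.
have hd_sub (C : set (set V)) N D : (forall X, C X -> submodule X) ->
    has_dev (interval C N D).
  move=> Cs; apply: (@has_dev_embed _ _ _ _ _ _ id) hd; last by [].
  by move=> X [/Cs].
pose S : set int := [set n | n != 0].
have [S1 SM] : S 1 /\ forall m n, S m -> S n -> S (m * n).
  by split=> // m n m0 n0; rewrite /S /= mulf_neq0.
have TV : submodule [set: V] by [].
have Salg r v : exists p : {poly int}, (exists i, S p`_i) /\ (map_poly intr p).[r] *: v = 0.
  have [p [pq pv]] := prim r v; exists p; split=> //; have [i ni] := pq 2 isT.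
  by exists i; apply: contraNneq ni => ->.
pose sat := saturated S setT.
have sat_sub X : sat X -> submodule X by case.
have sat_dcc N D : dcc (interval sat N D).
  apply: dcc_of_atoms => //.
    move=> F Fsat; split; first split.
    - by move=> i _; apply: submodule0; apply: (Fsat i).1.
    - by move=> x y Fx Fy i _; apply: submoduleD; [exact: (Fsat i).1|exact: Fx|exact: Fy].
    - by move=> r x Fx i _; apply: submoduleZ; [exact: (Fsat i).1|exact: Fx].
    - by move=> n x Sn _ Fx i _; apply: ((Fsat i).2 n) => //; apply: Fx.
  move=> N' D' Ns Ds _ _ ND; apply: exists_atom => //; last exact: hd_sub.
  move=> n x /negP; rewrite negbK => /eqP-> _.
  by rewrite scale0r; apply: submodule0; apply: Ns.1.
move=> a aA; have as_ i : submodule (a i) by apply: aA.1.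
pose b i := saturation S setT (a i).
have [k0 bk] : exists k : nat, forall i : nat, (k <= i)%N -> b i = b k.
  apply: (dcc_stable (sat_dcc set0 setT)); split=> i.
    by split=> //; apply: saturated_saturation.
  apply/subsetPset => x [_ [m Sm am]]; split=> //; exists m => //.
  by have /subsetPset := aA.2 i; apply.
exists k0 => i ki; rewrite (_ : poset_factor _ _ _ = interval submodule (a i.+1) (a i)); last first.
  apply/seteqP; split=> X; first by move=> [Xs /andP[/subsetPset ? /subsetPset ?]].
  by move=> [Xs ? ?]; split=> //; apply/andP; split; apply/subsetPset.
apply: dcc_of_atoms => //.
  move=> F Fs; split.
  - by move=> j _; apply: submodule0; apply: Fs.
  - by move=> x y Fx Fy j _; apply: submoduleD; [exact: Fs|exact: Fx|exact: Fy].
  - by move=> r x Fx j _; apply: submoduleZ; [exact: Fs|exact: Fx].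
move=> N D Ns Ds aN Da [ND [x Dx nNx]].
(* The isolators of [a i] and [a i.+1] agree, so a nonzero multiple of [x] falls into [a i.+1] and
   hence into [N]. *)
have [k k_gt0 Nk] : exists2 k : nat, (0 < k)%N & N (k%:R *: x).
  have : b i.+1 x.
    rewrite bk; last exact: leqW.
    by rewrite -(bk _ ki); split=> //; exists 1 => //; rewrite scale1r; apply: Da.
  move=> [_ [m Sm /aN Nm]]; exists `|m|%N; first by rewrite absz_gt0.
  case: m Nm {Sm} => m //=; rewrite NegzE rmorphN scaleNr => /(submoduleN Ns).
  by rewrite opprK.
(* Removing prime factors of [k] one at a time leads to an element of prime order modulo [N]. *)
have [q [y [qpr Dy nNy Nqy]]] : exists q y, [/\ prime q, D y, ~ N y & N (q%:R *: y)].
  elim/ltn_ind: k x Dx nNx k_gt0 Nk => k IH x Dx nNx k_gt0 Nk.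
  have k1 : (1 < k)%N.
    by case: k k_gt0 Nk {IH} => [|[|k]] //; rewrite scale1r.
  have dk := pdiv_dvd k; have qpr := pdiv_prime k1; set q := pdiv k in dk qpr.
  have kE : k = (k %/ q * q)%N by rewrite divnK.
  have [Nqx|nNqx] := pselect (N (q%:R *: x)); first by exists q, x.
  apply: (IH (k %/ q)%N _ (q%:R *: x)) => //.
  - by rewrite ltn_Pdiv // prime_gt1.
  - exact: submoduleZ.
  - by rewrite divn_gt0 ?prime_gt0// dvdn_leq.
  - by rewrite scalerA -natrM -kE.
pose D' : set V := [set z | D z /\ N (q%:R *: z)].
have D's : submodule D'.
  split=> [|u v [? ?] [? ?]|r u [? ?]].
  - by split; [exact: submodule0|rewrite scaler0; exact: submodule0].
  - by split; [exact: submoduleD|rewrite scalerDr; exact: submoduleD].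
  - by split; [exact: submoduleZ|rewrite scalerA mulrC -scalerA; exact: submoduleZ].
pose S' : set int := [set m | ~~ (q %| m)%Z].
(* Integers prime to [q] act invertibly on [D'] modulo [N] by a Bezout relation, so saturation is
   automatic. *)
have satE X : N `<=` X -> submodule X -> saturated S' D' X.
  move=> NX Xs; split=> // m u Sm [_ /NX Xqu] Xmu.
  have /coprimezP[[u1 u2] /= uE] : coprimez q m.
    by rewrite /coprimez /gcdz /= -[_ == _]/(coprime _ _) prime_coprime.
  rewrite -[u]scale1r -[1](rmorph1 intr) -uE rmorphD !rmorphM /= scalerDl -!scalerA.
  by apply: submoduleD => //; apply: submoduleZ.
have [|||||||||E [[Es _] NE Emin] ED'] := @exists_atom S' D' _ _ D's _ N D'.
- by rewrite /S' /= dvdz1 -[_ == _]/(_ == _) neq_ltn prime_gt1 ?orbT.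
- move=> m1 m2; rewrite /S' /= !dvdzE /= abszM Euclid_dvdM // => /negbTE-> /negbTE->.
  by [].
- move=> r v; have [p [pq pv]] := prim r v; exists p; split=> //.
  exact: pq.
- exact: satE.
- by apply: satE => // z Nz; split; [exact: ND|exact: submoduleZ].
- by [].
- by split; [move=> z Nz; split; [exact: ND|exact: submoduleZ]|exists y].
- move=> m z /negP; rewrite negbK => /dvdzP[c ->] [_ Nqz].
  by rewrite rmorphM /= -scalerA; apply: submoduleZ.
- by apply: hd_sub => X [].
exists E; last by move=> z /ED'[].
split=> // X Xs NX; apply: Emin => //; apply: satE => //; exact: NX.1.
Qed.

End Modules.

(** * Rings integral over a polynomial ring *)

Section IntegralRing.
Import GRing.Theory Num.Theory.
Local Open Scope ring_scope.

(* The case to keep in mind is a polynomial ring over [Z] in at least one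
   variable: modulo a suitable prime [q], [f] is nonzero and [b] is neither zero
   nor a divisor of a power of [f]. *)
Definition two_dimensional (P : idomainType) : Prop :=
  injective (fun n : nat => n%:R : P) /\
  forall f : P, f != 0 -> exists (q : nat) (b : P), prime q /\
    forall K L l s d, (b ^+ L * (f ^+ K + b * s)) ^+ l <> q%:R * d.

Lemma two_dimensional_polyint : two_dimensional {poly int}.
Proof.
split=> [m n /(congr1 (fun p : {poly int} => p`_0))|f f0].
  by rewrite -!polyC_natr !coefC /= => /eqP; rewrite eqr_nat => /eqP.
(* A prime above the leading coefficient keeps [f] nonzero modulo [q]. There [1 + 'X * f] is
   nonconstant and coprime to [f], so it divides no power of [f]. *)
have [q fq qpr] := prime_above `|lead_coef f|%N.
exists q, (1 + 'X * f); split=> // K L l s d E.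
have q0 : (q%:R : 'F_q) = 0 by rewrite pchar_Fp_0.
pose phi : {poly int} -> {poly 'F_q} := map_poly intr.
have phif : phi f != 0.
  apply/eqP => /(congr1 (fun p : {poly 'F_q} => p`_(size f).-1)).
  rewrite coef_map coef0 -[_`_ _]/(lead_coef f) /= => /eqP.
  rewrite (intEsign (lead_coef f)) rmorphM rmorph_sign mulf_eq0 signr_eq0 /=.
  rewrite -pmulrn -(dvdn_pcharf (pchar_Fp qpr)) gtnNdvd //.
  by rewrite absz_gt0 lead_coef_eq0.
have {E} := congr1 phi E.
rewrite /phi !(rmorphXn, rmorphM, rmorphD, rmorph1, rmorph_nat) /= map_polyX -/(phi f) -/(phi s).
rewrite -polyC_natr q0 mul0r => /eqP; set b := 1 + _.
have sb : size b = (size (phi f)).+1.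
  rewrite /b addrC size_polyDl ?size_mulX // 1?mulrC ?size_mulX //.
  by rewrite size_poly1 ltnS size_poly_gt0.
have b0 : b != 0 by rewrite -size_poly_gt0 sb.
rewrite expf_eq0 => /andP[_]; rewrite mulf_eq0 expf_eq0 (negbTE b0) andbF /=.
rewrite addr_eq0 => /eqP fb.
have : b %| gcdp b (phi f ^+ K).
  by rewrite dvdp_gcd dvdpp fb -mulrN dvdp_mulIl.
have /eqP cop : size (gcdp b (phi f ^+ K)) == 1%N.
  apply: coprimep_expr; apply/Bezout_coprimepP; exists (1, - 'X) => /=.
  by rewrite mul1r mulNr /b addrK eqpxx.
move/dvdp_leq; rewrite -size_poly_gt0 cop => /(_ isT); rewrite sb ltnS leqn0.
by rewrite size_poly_eq0 (negbTE phif).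
Qed.

(** The natural numbers give enough points of [P] to find one where [f] does not vanish; evaluation
    there turns a relation over [{poly P}] into one that [P] excludes. *)
Lemma two_dimensional_poly (P : idomainType) :
  two_dimensional P -> two_dimensional {poly P}.
Proof.
move=> [injP P2]; split=> [m n /(congr1 (fun p : {poly P} => p`_0))|f f0].
  by rewrite -!polyC_natr !coefC /= => /injP.
have [x fx] : exists x, f.[x] != 0.
  apply: contrapT => nox.
  have := @max_poly_roots _ f [seq (i%:R : P) | i <- iota 0 (size f)] f0.
  rewrite size_map size_iota ltnn map_inj_uniq // iota_uniq.
  suff -> : all (root f) [seq (i%:R : P) | i <- iota 0 (size f)] by move=> /(_ isT isT).
  apply/allP => y _; apply: contrapT => ny; apply: nox; exists y.
  by apply/negP => /eqP fy; apply: ny; apply/rootP.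
have [q [b [qpr qb]]] := P2 _ fx.
exists q, b%:P; split=> // K L l s d /(congr1 (horner_eval x)).
rewrite !(rmorphXn, rmorphM, rmorphD, rmorph_nat) /= !horner_evalE hornerC.
exact: qb.
Qed.

(** * Integral elements and leading coefficients *)

Section Integral.
Variables (P : idomainType) (K : comNzRingType) (phi : {rmorphism P -> K}).
Hypothesis phi_inj : injective phi.

Lemma integral_exp u n : integralOver phi u -> integralOver phi (u ^+ n).
Proof.
move=> iu; elim: n => [|n IH]; first exact: integral1.
by rewrite exprS; apply: integral_mul.
Qed.

Lemma integral_sum n (F : nat -> K) : (forall i, (i < n)%N -> integralOver phi (F i)) ->
  integralOver phi (\sum_(i < n) F i).
Proof.
move=> iF; apply: (big_ind (integralOver phi)) => [|x y|i _].
- exact: integral0.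
- exact: integral_add.
- exact: iF.
Qed.

(** Transitivity of integrality, applied to the monic polynomial ['X^n - (u ^+ n)%:P]. *)
Lemma integral_of_exp u n : (0 < n)%N -> integralOver phi (u ^+ n) -> integralOver phi u.
Proof.
move=> n0 iu; apply: (@integral_root_monic _ _ _ u ('X^n - (u ^+ n)%:P)).
- exact: monicXnsubC.
- by rewrite /root !hornerE subrr.
apply/integral_poly => i; rewrite coefB coefXn coefC; apply: integral_sub.
  exact: integral_nat.
by case: ifP => // _; apply: integral0.
Qed.

Lemma integral_relation u : integralOver phi u ->
  exists n (p : nat -> P), u ^+ n = \sum_(i < n) phi (p i) * u ^+ i.
Proof.
move=> [p pm]; rewrite /root (@horner_coef_wide _ (size p)) ?size_poly // => /eqP.
have -> : size p = (size p).-1.+1.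
  by rewrite prednK // size_poly_gt0 monic_neq0.
rewrite big_ord_recr /= coef_map /= -[p`_ _]/(lead_coef p) (monicP pm) rmorph1 mul1r.
move=> /eqP; rewrite addrC addr_eq0 => /eqP uE.
exists (size p).-1, (fun i => - p`_i); rewrite uE -sumrN; apply: eq_bigr => i _.
by rewrite coef_map /= rmorphN mulNr.
Qed.

Lemma relation_integral u n (p : nat -> P) :
  u ^+ n = \sum_(i < n) phi (p i) * u ^+ i -> integralOver phi u.
Proof.
move=> uE; exists ('X^n - \poly_(i < n) p i).
  have sp : (size (\poly_(i < n) p i) < size ('X^n : {poly P}))%N.
    by rewrite size_polyXn ltnS size_poly.
  rewrite monicE lead_coefDl ?size_polyN // lead_coefXn.
  exact: eqxx.
rewrite rmorphB /= map_polyXn /root !hornerE uE subr_eq0; apply/eqP.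
rewrite (@horner_coef_wide _ n); last exact: leq_trans (size_poly _ _) (size_poly _ _).
by apply: eq_bigr => i _; rewrite coef_map coef_poly ltn_ord.
Qed.

(** Multiplying a relation of degree [n] by the power [n - 1] of its leading coefficient [a] makes
    it monic in [a * u]. In degree 0 the image of [a] would vanish, against injectivity. *)
Lemma integral_lead_coef (g : {poly P}) u : g != 0 -> root (map_poly phi g) u ->
  integralOver phi (phi (lead_coef g) * u).
Proof.
move=> g0; rewrite /root (@horner_coef_wide _ (size g)) ?size_poly // => /eqP.
set a := lead_coef g; have a0 : a != 0 by rewrite lead_coef_eq0.
have -> : size g = (size g).-1.+1 by rewrite prednK // size_poly_gt0.
rewrite big_ord_recr /= coef_map /= -[g`_ _]/a; set n := (size g).-1 => gu.
apply: (@relation_integral _ n (fun i => - (g`_i * a ^+ (n.-1 - i)))).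
case: n gu => [|n].
  rewrite big_ord0 add0r mulr1 => /eqP; rewrite -(rmorph0 phi) (inj_eq phi_inj).
  by rewrite (negbTE a0).
move=> /eqP; rewrite addrC addr_eq0 => /eqP gu.
rewrite exprMn exprSr -mulrA gu mulrN mulr_sumr -sumrN; apply: eq_bigr => i _.
have iE : n = (n - i + i)%N by rewrite subnK // -ltnS.
rewrite coef_map /= rmorphN rmorphM rmorphXn /= exprMn {1}iE exprD mulNr; congr (- _).
by ring.
Qed.
End Integral.

(** A transcendence basis is grown along [bs], starting from [h]: an element algebraic over [P]
    changes nothing, any other one becomes the variable of [{poly P}], and its transcendence keeps
    the map injective. *)
Lemma polynomial_tower (K : comNzRingType) (h : K) (bs : seq K) :
  (forall p : {poly int}, p != 0 -> (map_poly intr p).[h] != 0) ->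
  exists (P : idomainType) (phi : {rmorphism P -> K}),
    [/\ injective phi, two_dimensional P
      & {in bs, forall b, exists2 g : {poly P}, g != 0 & root (map_poly phi g) b}].
Proof.
move=> htr; elim: bs => [|b bs [P [phi [phi_inj P2 alg]]]].
  have cfu : commr_rmorph (intr : int -> K) h by move=> x; apply: mulrC.
  exists {poly int}, (horner_morph cfu); split=> //; last exact: two_dimensional_polyint.
  apply: raddf_inj => p p0; apply/eqP; apply: contraT => /htr.
  by rewrite -[_.[_]]/(horner_morph cfu p) p0 eqxx.
have [[g g0 gb]|nog] := pselect (exists2 g : {poly P}, g != 0 & root (map_poly phi g) b).
  exists P, phi; split=> // c; rewrite in_cons => /orP[/eqP->|]; last exact: alg.
  by exists g.
have cfu : commr_rmorph phi b by move=> x; apply: mulrC.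
exists {poly P}, (horner_morph cfu); split.
- apply: raddf_inj => p p0; apply/eqP; apply: contraT => pn0; exfalso; apply: nog.
  by exists p => //; apply/rootP.
- exact: two_dimensional_poly.
move=> c; rewrite in_cons => /orP[/eqP->|/alg[g g0 gc]].
  exists ('X - ('X)%:P); first by rewrite polyXsubC_eq0.
  by rewrite rmorphB /= map_polyX map_polyC /= horner_morphX root_XsubC.
exists (map_poly polyC g); first by rewrite map_polyC_eq0.
rewrite -map_poly_comp (eq_map_poly (g := phi)) // => x /=; exact: horner_morphC.
Qed.

(* The second hypothesis makes [K] integral over the subring generated by [bs]. *)
Lemma not_one_dimensional (K : comNzRingType) (h : K) (bs : seq K) :
  (forall p : {poly int}, p != 0 -> (map_poly intr p).[h] != 0) ->
  (forall J : K -> Prop, J 1 -> (forall x y, J x -> J y -> J (x - y)) ->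
    (forall x y, J x -> J y -> J (x * y)) ->
    (forall x n, (0 < n)%N -> J (x ^+ n) -> J x) ->
    {in bs, forall b, J b} -> forall x, J x) ->
  exists q (b : K), prime q /\ forall n c d, b ^+ n <> b ^+ n.+1 * c + q%:R * d.
Proof.
move=> htr gen; have [P [phi [phi_inj [_ P2] alg]]] := polynomial_tower bs htr.
(* A common denominator, the product of the leading coefficients of the relations. *)
have [f f0 fint] : exists2 f, f != 0 & {in bs, forall b, integralOver phi (phi f * b)}.
  elim: bs alg {gen} => [|b bs IH] alg; first by exists 1; rewrite ?oner_eq0.
  have [|f f0 fint] := IH; first by move=> c cbs; apply: alg; rewrite in_cons cbs orbT.
  have [|g g0 /(integral_lead_coef phi_inj g0) gb] := alg b; first exact: mem_head.
  exists (lead_coef g * f); first by rewrite mulf_neq0 // lead_coef_eq0.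
  move=> c; rewrite rmorphM in_cons => /orP[/eqP->|/fint].
    by rewrite mulrAC; apply: integral_mul => //; apply: integral_id.
  by rewrite -mulrA; apply: integral_mul; apply: integral_id.
have intf k : integralOver phi (phi f ^+ k) by apply: integral_exp; apply: integral_id.
(* The elements made integral by some power of [f] form a subring closed under roots, so by [gen]
   they exhaust [K]. *)
have denom : forall x, exists k, integralOver phi (phi f ^+ k * x).
  apply: gen.
  - by exists 0; rewrite mulr1; apply: intf.
  - move=> x y [k kx] [l ly]; exists (k + l)%N; rewrite exprD mulrBr.
    apply: integral_sub; last by rewrite -mulrA; apply: integral_mul.
    by rewrite mulrAC mulrC; apply: integral_mul.
  - move=> x y [k kx] [l ly]; exists (k + l)%N; rewrite exprD mulrACA.
    exact: integral_mul.
  - move=> x n n0 [k kx]; exists k; apply: (integral_of_exp n0).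
    rewrite exprMn -(prednK n0) exprS mulrAC mulrC prednK //.
    by apply: integral_mul => //; apply: integral_exp.
  - by move=> b /fint ib; exists 1.
have [q [b0 [qpr qb]]] := P2 f f0.
exists q, (phi b0); split=> // n c d E; set b := phi b0 in E.
have ib : integralOver phi b by apply: integral_id.
have [m [ic id]] : exists m, integralOver phi (phi f ^+ m * c) /\ integralOver phi (phi f ^+ m * d).
  have [[k kc] [l ld]] := (denom c, denom d); exists (k + l)%N; rewrite exprD; split.
    by rewrite mulrAC mulrC; apply: integral_mul.
  by rewrite -mulrA; apply: integral_mul.
(* Denominators are cleared: the assumed equation becomes [x = Y * c' + q%:R * d'] with integral
   [c'] and [d']. *)
set c' := _ * c in ic; set d' := _ * d in id.
pose x := phi f ^+ m * b ^+ n; pose Y := b ^+ n.+1.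
have xE : x = Y * c' + q%:R * d'.
  by rewrite /x E mulrDr /c' /d' /Y !(mulrCA (phi f ^+ m)).
have ix : integralOver phi x by apply: integral_mul => //; apply: integral_exp.
have iY : integralOver phi Y by apply: integral_exp.
have xpow i : exists2 o, integralOver phi o & x ^+ i = (Y * c') ^+ i + q%:R * o.
  elim: i => [|i [o io xi]].
    by exists 0; [exact: integral0|rewrite mulr0 addr0].
  exists (d' * (Y * c') ^+ i + x * o).
    apply: integral_add; apply: integral_mul => //.
    by apply: integral_exp; apply: integral_mul.
  by rewrite exprS xi mulrDr {1}xE exprS; ring.
have [e [p c'E]] := integral_relation ic.
have /choice[o oP] : forall i, exists o, integralOver phi o /\
    x ^+ i = (Y * c') ^+ i + q%:R * o.
  by move=> i; have [o] := xpow i; exists o.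
(* The relation of degree [e] for [c'], multiplied by [Y ^+ e] and with [Y * c'] replaced by [x]
   modulo [q], becomes [G]; every term of the sum contains one more factor [b0] than [x ^+ e]. *)
pose s := - \sum_(i < e) p i * b0 ^+ (e - i.+1) * f ^+ (m * i).
pose G := b0 ^+ (n * e) * (f ^+ (m * e) + b0 * s).
have [o' io' GE] : exists2 o', integralOver phi o' & phi G = q%:R * o'.
  exists (o e - \sum_(i < e) phi (p i) * Y ^+ (e - i) * o i).
    apply: integral_sub; first exact: (oP e).1.
    apply: (@integral_sum _ _ _ e (fun i => phi (p i) * Y ^+ (e - i) * o i)) => i _.
    apply: integral_mul; last exact: (oP i).1.
    by apply: integral_mul; [apply: integral_id|apply: integral_exp].
  have -> : phi G = x ^+ e - \sum_(i < e) phi (p i) * Y ^+ (e - i) * x ^+ i.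
    rewrite rmorphM rmorphD rmorphM rmorphN rmorph_sum !rmorphXn /= -/b mulrDr.
    congr (_ + _); first by rewrite /x exprMn -!exprM mulrC.
    rewrite !mulrN; congr (- _); rewrite !mulr_sumr; apply: eq_bigr => i _.
    rewrite !rmorphM !rmorphXn /= -/b /x /Y exprMn -!exprM.
    have -> : (n.+1 * (e - i) = n * (e - i) + (e - i.+1).+1)%N.
      by rewrite subnSK // mulSn addnC.
    have {1}-> : (n * e = n * (e - i) + n * i)%N by rewrite -mulnDr subnK // ltnW.
    by rewrite !exprD exprS; ring.
  rewrite (oP e).2 exprMn c'E mulr_sumr mulrBr addrAC; apply/eqP.
  rewrite -subr_eq0; apply/eqP; rewrite [X in X - _](_ : _ = - \sum_(i < e) q%:R * (phi (p i) * Y ^+ (e - i) * o i) + q%:R * o e).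
    by rewrite mulr_sumr; ring.
  congr (_ + _); rewrite -sumrB -sumrN; apply: eq_bigr => i _.
  rewrite (oP i).2 [(Y * c') ^+ i]exprMn.
  have -> : Y ^+ e = Y ^+ (e - i) * Y ^+ i by rewrite -exprD subnK // ltnW.
  by ring.
(* Multiplying the integral relation for [o'] by [q%:R ^+ l] exhibits [G ^+ l] as a multiple of [q]
   already in [P], which the choice of [b0] forbids. *)
have [l [p' o'E]] := integral_relation io'.
apply: (qb (m * e)%N (n * e)%N l s (\sum_(i < l) p' i * q%:R ^+ (l - i.+1) * G ^+ i)).
apply: phi_inj; rewrite -/G rmorphXn GE exprMn o'E rmorphM rmorph_nat rmorph_sum !mulr_sumr.
apply: eq_bigr => i _; rewrite !rmorphM !rmorphXn rmorph_nat /= GE exprMn.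
have {1}-> : (l = (l - i.+1).+1 + i)%N by rewrite addSn -addnS subnK.
by rewrite exprD exprS; ring.
Qed.

End IntegralRing.

(** * The abelian normal subgroup and its quotient as modules *)

Section Annihilator.
Import GRing.Theory.
Local Open Scope ring_scope.
Variables (R : comNzRingType) (V : lmodType R) (v : V).
Hypothesis v0 : v != 0.

Let ann : {pred R} := fun r => r *: v == 0.

Fact ann_idealr : idealr_closed ann.
Proof.
split; rewrite ?unfold_in ?scale0r ?scale1r //=.
move=> a x y; rewrite !unfold_in /= scalerDl -scalerA => /eqP-> /eqP->.
by rewrite scaler0 addr0.
Qed.
HB.instance Definition _ := isIdealr.Build R ann ann_idealr.

(** Since [v] is nonzero, its annihilator is a proper ideal and the quotient is a nonzero ring. *)
Lemma annihilator_quotient : exists (K : comNzRingType) (pi : {rmorphism R -> K}),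
  (forall x, exists r, pi r = x) /\ forall r, pi r = 0 <-> r *: v = 0.
Proof.
exists {ideal_quot ann}, (\pi_({ideal_quot ann}))%qT; split=> [x|r].
  by exists (repr x); rewrite /= reprK.
have -> : (r *: v = 0) <-> (r \in ann) by rewrite unfold_in; split=> /eqP.
rewrite -[r in r \in _]subr0 Quotient.idealrBE; pose pi : {rmorphism R -> {ideal_quot ann}} := \pi_({ideal_quot ann})%qT.
rewrite -[X in X == _]/(pi r) -[X in _ == X]/(pi 0) rmorph0.
by split=> [/= ->//|/eqP].
Qed.
End Annihilator.

Section Modules.
Variables (G : groupType) (M : set G).
Hypotheses (M_normal : normal_subgroup M setT) (M_abelian : abelian_subgroup M)
  (B_abelian : abelian_quotient setT M).
Local Open Scope classical_set_scope.
Local Open Scope group_scope.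

Lemma subgroup1 (H : set G) : subgroup H -> H 1.
Proof. by case; rewrite inE. Qed.
Lemma subgroupVM (H : set G) x y : subgroup H -> H x -> H y -> H (x * y^-1).
Proof. by case=> _ /(_ x y); rewrite !inE; auto. Qed.
Lemma subgroupV (H : set G) x : subgroup H -> H x -> H x^-1.
Proof. by move=> Hs Hx; rewrite -[_^-1]mul1g; apply: subgroupVM => //; apply: subgroup1. Qed.
Lemma subgroupM (H : set G) x y : subgroup H -> H x -> H y -> H (x * y).
Proof. by move=> Hs Hx Hy; rewrite -[y]invgK; apply: subgroupVM => //; apply: subgroupV. Qed.
Lemma subgroup_intro (H : set G) :
  H 1 -> (forall x y, H x -> H y -> H (x * y^-1)) -> subgroup H.
Proof. by move=> H1 HB; split; [rewrite inE|move=> x y; rewrite !inE; exact: HB]. Qed.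
Lemma normalJ (H : set G) x g : normal_subgroup H setT -> H x -> H (x ^ g).
Proof. by case=> _ _ + Hx; apply. Qed.
Lemma normal_sub (H : set G) : normal_subgroup H setT -> subgroup H.
Proof. by case. Qed.

Let Ms := normal_sub M_normal.

Lemma quotient_commute g h : exists2 m, M m & g * h = h * g * m.
Proof.
have := B_abelian (ex_intro2 _ _ g I erefl) (ex_intro2 _ _ h I erefl).
move/seteqP => [/(_ (g * h)) sub _].
have [|_ [m Mm <-] [_ [m' Mm' <-] <-]] := sub.
  exists g; first by exists 1; [exact: subgroup1|rewrite mulg1].
  by exists h => //; exists 1; [exact: subgroup1|rewrite mulg1].
exists (m ^ g * m').
  by apply: subgroupM => //; apply: normalJ.
by rewrite conjgE !mulgA mulgK.
Qed.

(** The hypotheses are parameters of the type, so that the module structure, whose laws rest on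
    them, can be attached to it. *)
Definition kernel_module of normal_subgroup M setT & abelian_subgroup M
  & abelian_quotient setT M : Type := {x : G | M x}.
Let U := kernel_module M_normal M_abelian B_abelian.
HB.instance Definition _ := gen_eqMixin U.
HB.instance Definition _ := gen_choiceMixin U.

Definition uval (u : U) : G := sval u.
Definition umk x (Mx : M x) : U := exist _ x Mx.

Lemma uvalP (u : U) : M (uval u). Proof. exact: svalP. Qed.
Lemma uval_inj : injective uval.
Proof. by move=> [x Mx] [y My] /= E; case: y / E My => My; congr exist. Qed.

Definition uadd (u v : U) : U := umk (subgroupM Ms (uvalP u) (uvalP v)).
Definition uopp (u : U) : U := umk (subgroupV Ms (uvalP u)).
Definition uzero : U := umk (subgroup1 Ms).

Fact uaddA : associative uadd.
Proof. by move=> u v w; apply: uval_inj; rewrite /= mulgA. Qed.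
Fact uaddC : commutative uadd.
Proof. by move=> u v; apply: uval_inj; apply: M_abelian; apply: uvalP. Qed.
Fact uadd0 : left_id uzero uadd.
Proof. by move=> u; apply: uval_inj; rewrite /= mul1g. Qed.
Fact uaddN : left_inverse uzero uopp uadd.
Proof. by move=> u; apply: uval_inj; rewrite /= mulVg. Qed.
HB.instance Definition _ := GRing.isZmodule.Build U uaddA uaddC uadd0 uaddN.

Local Open Scope ring_scope.
Import GRing.Theory Num.Theory.

Lemma uvalD u v : uval (u + v) = (uval u * uval v)%g. Proof. by []. Qed.
Lemma uvalN u : uval (- u) = ((uval u)^-1)%g. Proof. by []. Qed.
Lemma uval0 : uval 0 = 1%g. Proof. by []. Qed.
Lemma uvalMn u n : uval (u *+ n) = (uval u ^+ n)%g.
Proof. by elim: n => // n IH; rewrite mulrS uvalD IH expgS. Qed.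

Definition conj_op (g : G) (u : U) : U := umk (normalJ g M_normal (uvalP u)).

Lemma conj_opM g h u : conj_op (g * h)%g u = conj_op h (conj_op g u).
Proof. by apply: uval_inj; rewrite /= conjgM. Qed.

Lemma conj_op_id g u : M g -> conj_op g u = u.
Proof.
move=> Mg; apply: uval_inj; rewrite /= conjgE -[in X in (_ * X)%g](M_abelian Mg (uvalP u)).
by rewrite mulgA mulVg mul1g.
Qed.

(** Commutators lie in [M], and [M] acts trivially on itself. *)
Lemma conj_opC g h u : conj_op g (conj_op h u) = conj_op h (conj_op g u).
Proof.
have [m Mm E] := quotient_commute h g.
by rewrite -!conj_opM E conj_opM conj_op_id.
Qed.

(* The endomorphisms of [M] generated by conjugation.  The augmentation [a]
   carried along makes this ring nontrivial even when [M] is trivial. *)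
Inductive operator : (U -> U) -> int -> Prop :=
| OperatorOne : operator id 1
| OperatorConj g : operator (conj_op g) 1
| OperatorSub f f' a a' : operator f a -> operator f' a' ->
    operator (fun u => f u - f' u) (a - a')
| OperatorMul f f' a a' : operator f a -> operator f' a' ->
    operator (f \o f') (a * a').

Lemma operatorB f a u v : operator f a -> f (u - v) = f u - f v.
Proof.
move=> fP; elim: fP u v => // [g|{}f f' _ _ _ IH _ IH'|{}f f' _ _ _ IH _ IH'] u v.
- by apply: uval_inj; rewrite !(uvalD, uvalN) /= conjMg conjVg.
- by rewrite IH IH' !opprD !opprK addrACA.
- by rewrite /= IH' IH.
Qed.

Lemma operator0 f a : operator f a -> f 0 = 0.
Proof. by move=> fP; rewrite -[X in f X](subrr 0) (operatorB _ _ fP) subrr. Qed.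

Lemma operatorD f a u v : operator f a -> f (u + v) = f u + f v.
Proof.
by move=> fP; rewrite -{1}[v]opprK (operatorB _ _ fP) -[- v]sub0r (operatorB _ _ fP)
  (operator0 fP) sub0r opprK.
Qed.

Lemma operatorC f a f' a' u : operator f a -> operator f' a' -> f (f' u) = f' (f u).
Proof.
move=> fP; elim: fP f' a' u => // [g|{}f f1 b b1 fP IH fP1 IH1|{}f f1 b b1 fP IH fP1 IH1] f' a' u f'P.
- elim: f'P u => // [h|{}f' f'' _ _ _ IH _ IH'|{}f' f'' _ _ _ IH _ IH'] u.
  + exact: conj_opC.
  + by rewrite (operatorB _ _ (OperatorConj g)) IH IH'.
  + by rewrite /= IH IH'.
- by rewrite (IH _ _ _ f'P) (IH1 _ _ _ f'P) (operatorB _ _ f'P).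
- by rewrite /= (IH1 _ _ _ f'P) (IH _ _ _ f'P).
Qed.

Record operators_of : Type := Oper {
  oper_fun :> U -> U; oper_aug : int; operP : operator oper_fun oper_aug
}.

Let O := operators_of.
HB.instance Definition _ := gen_eqMixin O.
HB.instance Definition _ := gen_choiceMixin O.

Lemma oper_eq (r s : O) : r =1 s -> oper_aug r = oper_aug s -> r = s.
Proof.
case: r s => [f a fP] [f' a' f'P] /= /funext ff' aa'.
by case: f' / ff' f'P; case: a' / aa' => f'P; rewrite (Prop_irrelevance fP f'P).
Qed.

Fact operator_zero : operator (fun=> 0) 0.
Proof.
have := OperatorSub OperatorOne OperatorOne; rewrite subrr.
by congr operator; apply/funext => u; rewrite subrr.
Qed.
Fact operator_opp f a : operator f a -> operator (fun u => - f u) (- a).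
Proof.
move=> fP; have := OperatorSub operator_zero fP; rewrite sub0r.
by congr operator; apply/funext => u; rewrite sub0r.
Qed.
Fact operator_add f a f' a' : operator f a -> operator f' a' ->
  operator (fun u => f u + f' u) (a + a').
Proof.
move=> fP f'P; have := OperatorSub fP (operator_opp f'P); rewrite opprK.
by congr operator; apply/funext => u; rewrite opprK.
Qed.

Definition oper_zero : O := Oper operator_zero.
Definition oper_opp (r : O) : O := Oper (operator_opp (operP r)).
Definition oper_add (r s : O) : O := Oper (operator_add (operP r) (operP s)).
Definition oper_one : O := Oper OperatorOne.
Definition oper_mul (r s : O) : O := Oper (OperatorMul (operP r) (operP s)).
Definition oper_conj g : O := Oper (OperatorConj g).

Fact oper_addA : associative oper_add.
Proof. by move=> r s t; apply: oper_eq => [u|]; rewrite /= addrA. Qed.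
Fact oper_addC : commutative oper_add.
Proof. by move=> r s; apply: oper_eq => [u|]; rewrite /= addrC. Qed.
Fact oper_add0 : left_id oper_zero oper_add.
Proof. by move=> r; apply: oper_eq => [u|]; rewrite /= add0r. Qed.
Fact oper_addN : left_inverse oper_zero oper_opp oper_add.
Proof. by move=> r; apply: oper_eq => [u|]; rewrite /= addNr. Qed.
HB.instance Definition _ :=
  GRing.isZmodule.Build O oper_addA oper_addC oper_add0 oper_addN.

Fact oper_mulA : associative oper_mul.
Proof. by move=> r s t; apply: oper_eq => [u|] //=; rewrite mulrA. Qed.
Fact oper_mulC : commutative oper_mul.
Proof.
move=> r s; apply: oper_eq => [u|] /=; last exact: mulrC.
exact: operatorC (operP r) (operP s).
Qed.
Fact oper_mul1 : left_id oper_one oper_mul.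
Proof. by move=> r; apply: oper_eq => [u|] //=; rewrite mul1r. Qed.
Fact oper_mulDl : left_distributive oper_mul oper_add.
Proof. by move=> r s t; apply: oper_eq => [u|] //=; rewrite mulrDl. Qed.
Fact oper_one_neq0 : oper_one != oper_zero.
Proof. by apply/eqP => /(congr1 (@oper_aug)) /eqP; rewrite oner_eq0. Qed.
HB.instance Definition _ := GRing.Zmodule_isComNzRing.Build O
  oper_mulA oper_mulC oper_mul1 oper_mulDl oper_one_neq0.

Definition oper_scale (r : O) (u : U) : U := r u.
Fact oper_scaleA r s u : oper_scale r (oper_scale s u) = oper_scale (r * s) u.
Proof. by []. Qed.
Fact oper_scale1 : left_id 1 oper_scale. Proof. by []. Qed.
Fact oper_scaleDr : right_distributive oper_scale +%R.
Proof. by move=> r u v; apply: operatorD (operP r). Qed.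
Fact oper_scaleDl u : {morph oper_scale^~ u : r s / r + s}.
Proof. by []. Qed.
HB.instance Definition _ := GRing.Zmodule_isLmodule.Build O U
  oper_scaleA oper_scale1 oper_scaleDr oper_scaleDl.

Lemma uval_conj g (u : U) : uval (oper_conj g *: u) = (uval u ^ g)%g.
Proof. by []. Qed.

Lemma oper_conjM g h : oper_conj (g * h)%g = oper_conj h * oper_conj g.
Proof. by apply: oper_eq => // u; apply: conj_opM. Qed.

Lemma oper_conj1 g : M g -> oper_conj g = 1.
Proof. by move=> Mg; apply: oper_eq => // u; apply: conj_op_id. Qed.

Lemma oper_conjX g n : oper_conj (g ^+ n)%g = oper_conj g ^+ n.
Proof.
elim: n => [|n IH]; first by rewrite expg0 oper_conj1 //; apply: subgroup1.
by rewrite expgS oper_conjM IH exprSr.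
Qed.

(** The derivation is generalised before the induction; [oper_eq] identifies operators that differ
    only in their derivation. *)
Lemma oper_ind (J : O -> Prop) : J 1 -> (forall g, J (oper_conj g)) ->
  (forall r s, J r -> J s -> J (r - s)) -> (forall r s, J r -> J s -> J (r * s)) ->
  forall r, J r.
Proof.
move=> J1 Jc JB JM [f a fP]; elim: {f a} fP (fP) => [|g|f f' a a' fP IH f'P IH'|f f' a a' fP IH f'P IH'] P.
- by rewrite (_ : Oper P = (1 : O)) //; apply: oper_eq.
- by rewrite (_ : Oper P = oper_conj g) //; apply: oper_eq.
- by rewrite (_ : Oper P = (Oper fP : O) - (Oper f'P : O)); [apply: JB|apply: oper_eq].
- by rewrite (_ : Oper P = (Oper fP : O) * (Oper f'P : O)); [apply: JM|apply: oper_eq].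
Qed.

(** * Normal subgroups of [G] and submodules of [M] *)

Definition normals : set (set G) := [set N | normal_subgroup N setT].

Definition kernel_trace (N : set G) : set U := [set u | N (uval u)].
Definition kernel_image (X : set U) : set G := [set uval u | u in X].

Lemma submodule_trace N : normal_subgroup N setT -> submodule (kernel_trace N).
Proof.
move=> Nn; have Ns := normal_sub Nn; split.
- exact: subgroup1.
- by move=> u v; apply: subgroupM.
apply: oper_ind => [u|g u|r s IHr IHs u Nu|r s IHr IHs u /IHs/IHr].
- by rewrite scale1r.
- exact: normalJ.
- rewrite scalerBl; exact: (subgroupVM Ns (IHr u Nu) (IHs u Nu)).
- by rewrite scalerA.
Qed.

Lemma normal_image X : submodule X -> normal_subgroup (kernel_image X) setT.
Proof.
move=> Xs; split=> //.
  apply: subgroup_intro; first by exists 0 => //; apply: submodule0.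
  by move=> _ _ [u Xu <-] [v Xv <-]; exists (u - v) => //; apply: submoduleB.
by move=> _ g [u Xu <-] _; exists (oper_conj g *: u) => //; apply: submoduleZ.
Qed.

Lemma kernel_image_mono : strict_mono (@submodules O U) kernel_image.
Proof.
move=> X Y _ _ /subsetPset XY; split.
  by apply/subsetPset => _ [u Xu <-]; exists u => //; apply: XY.
move=> E; apply/seteqP; split=> // u Yu.
have : kernel_image X (uval u) by rewrite E; exists u.
by move=> [v Xv /uval_inj <-].
Qed.

(** * The quotient of [G] by [M] as an additive group *)

Definition quotient_group of normal_subgroup M setT & abelian_quotient setT M : Type :=
  {C : set G | quotient setT M C}.
Let Q := quotient_group M_normal B_abelian.
HB.instance Definition _ := gen_eqMixin Q.
HB.instance Definition _ := gen_choiceMixin Q.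

Definition cls (g : G) : Q := exist _ (lcoset M g) (ex_intro2 _ _ g I erefl).

Lemma cls_eq g h : cls g = cls h <-> M (g^-1 * h)%g.
Proof.
split=> [/(congr1 sval) /= E|Mgh].
  have : lcoset M h h by exists 1%g; [exact: subgroup1|rewrite mulg1].
  by rewrite -E => -[m Mm <-]; rewrite mulKg.
have E : lcoset M g = lcoset M h.
  apply/seteqP; split=> _ [m Mm <-].
    exists ((g^-1 * h)^-1 * m)%g; last by rewrite invgM invgK !mulgA mulgV mul1g.
    by apply: subgroupM => //; apply: subgroupV.
  by exists ((g^-1 * h) * m)%g; [exact: subgroupM|rewrite !mulgA mulgV mul1g].
rewrite /cls; move: (ex_intro2 _ _ h _ _) => p; case: _ / E p => p.
by congr exist.
Qed.

Lemma cls_rep (q : Q) : exists g, cls g = q.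
Proof.
case: q => C [g gT gC]; exists g; rewrite /cls.
move: (ex_intro2 _ _ g _ _) (ex_intro2 _ _ g gT gC) => p p'.
by case: _ / gC p p' => p p'; congr exist.
Qed.

Definition qrep (q : Q) : G := sval (cid (cls_rep q)).
Lemma qrepK q : cls (qrep q) = q. Proof. exact: svalP (cid (cls_rep q)). Qed.

Definition qadd (p q : Q) : Q := cls (qrep p * qrep q)%g.
Definition qopp (p : Q) : Q := cls (qrep p)^-1%g.

Lemma cls_mulr g h h' : cls h = cls h' -> cls (g * h)%g = cls (g * h')%g.
Proof. by rewrite !cls_eq invgM -mulgA mulKg. Qed.
Lemma cls_mull g g' h : cls g = cls g' -> cls (g * h)%g = cls (g' * h)%g.
Proof.
rewrite !cls_eq invgM => /(normalJ h M_normal).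
by rewrite conjgE !mulgA.
Qed.
Lemma clsC g h : cls (g * h)%g = cls (h * g)%g.
Proof. by have [m Mm ->] := quotient_commute h g; apply/cls_eq; rewrite mulKg. Qed.

Fact qadd_cls g h : qadd (cls g) (cls h) = cls (g * h)%g.
Proof.
rewrite /qadd (@cls_mulr _ _ h) ?qrepK //; apply: cls_mull; exact: qrepK.
Qed.
Fact qaddA : associative qadd.
Proof.
by move=> p q r; rewrite -[p]qrepK -[q]qrepK -[r]qrepK !qadd_cls mulgA.
Qed.
Fact qaddC : commutative qadd.
Proof. by move=> p q; apply: clsC. Qed.
Fact qadd0 : left_id (cls 1%g) qadd.
Proof. by move=> p; rewrite -[p]qrepK qadd_cls mul1g. Qed.
Fact qaddN : left_inverse (cls 1%g) qopp qadd.
Proof. by move=> p; rewrite -{2}[p]qrepK /qopp qadd_cls mulVg. Qed.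
HB.instance Definition _ := GRing.isZmodule.Build Q qaddA qaddC qadd0 qaddN.

Lemma clsM g h : cls (g * h)%g = cls g + cls h. Proof. by rewrite -qadd_cls. Qed.
Lemma cls1 : cls 1%g = 0. Proof. by []. Qed.
Lemma clsV g : cls (g^-1)%g = - cls g.
Proof. by apply/eqP; rewrite -addr_eq0 -clsM mulVg cls1. Qed.
Lemma clsX g n : cls (g ^+ n)%g = cls g *+ n.
Proof. by elim: n => // n IH; rewrite expgS clsM IH mulrS. Qed.
End Modules.

(** * Krull dimension at most one and algebraic actions *)

Section KrullDimension.
Variables (G : groupType) (M : set G).
Hypotheses (M_normal : normal_subgroup M setT) (M_abelian : abelian_subgroup M)
  (B_abelian : abelian_quotient setT M).
Local Open Scope classical_set_scope.
Local Open Scope ring_scope.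
Import GRing.Theory Num.Theory.

Let U := kernel_module M_normal M_abelian B_abelian.
Let O := operators_of M_normal M_abelian B_abelian.
Let Q := quotient_group M_normal B_abelian.
Let cls : G -> Q := cls M_normal B_abelian.
Let conj : G -> O := oper_conj M_normal M_abelian B_abelian.
Local Notation trace := (@kernel_trace G M M_normal M_abelian B_abelian).
Local Notation normals := (@normals G).
Local Notation Usub := (@submodules O U).
Local Notation Qsub := (@submodules int (zmodule Q)).

Lemma int_submodule (X : set (zmodule Q)) : X 0 ->
  (forall x y, X x -> X y -> X (x + y)) -> (forall x, X x -> X (- x)) ->
  submodule X.
Proof.
move=> X0 XD XN; split=> // -[n|n] x Xx; rewrite scalezrE.
  by rewrite -pmulrn; elim: n => [|n IH]; rewrite ?mulr0n// mulrS; apply: XD.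
rewrite NegzE mulrNz; apply: XN; rewrite -pmulrn.
by elim: n => [|n IH]; rewrite ?mulr1n// mulrS; apply: XD.
Qed.

Definition quotient_image (N : set G) : set (zmodule Q) := [set cls g | g in N].
Definition quotient_preimage (Y : set (zmodule Q)) : set G := [set g | Y (cls g)].

Lemma submodule_image N : normal_subgroup N setT -> submodule (quotient_image N).
Proof.
move=> /normal_sub Ns; apply: int_submodule.
- by exists 1%g; [exact: subgroup1|exact: cls1].
- move=> _ _ [g Ng <-] [h Nh <-]; exists (g * h)%g; first exact: subgroupM.
  exact: clsM.
- by move=> _ [g Ng <-]; exists g^-1%g; [exact: subgroupV|exact: clsV].
Qed.

Lemma normal_preimage Y : submodule Y -> normal_subgroup (quotient_preimage Y) setT.
Proof.
move=> Ys; have D (x y : Q) : Y x -> Y y -> Y (x + y).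
  by move=> Yx Yy; exact: (submoduleD Ys Yx Yy).
have B (x : Q) : Y x -> Y (- x) by move=> Yx; exact: (submoduleN Ys Yx).
split=> // [|g h Yg _].
  apply: subgroup_intro; first by rewrite /quotient_preimage /= /cls cls1; exact: (submodule0 Ys).
  by move=> g h Yg Yh; rewrite /quotient_preimage /= /cls clsM clsV; apply: D => //; apply: B.
rewrite /quotient_preimage /= /cls conjgE !clsM clsV addrC -addrA subrr addr0.
exact: Yg.
Qed.

Lemma has_dev_kernel : has_dev normals -> has_dev Usub.
Proof.
by apply: has_dev_embed; [move=> X; exact: normal_image|exact: kernel_image_mono].
Qed.

Lemma has_dev_quotient : has_dev normals -> has_dev Qsub.
Proof.
apply: has_dev_embed; first by move=> Y; exact: normal_preimage.
move=> X Y _ _ /subsetPset XY; split; first by apply/subsetPset => g /XY.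
move=> E; apply/seteqP; split=> // q Yq.
have [g gE] : exists g, cls g = q by exact: cls_rep.
have : quotient_preimage X g by rewrite E /quotient_preimage /= gE.
by rewrite /quotient_preimage /= gE.
Qed.

(** Over the integers each scalar [r] is a root of the primitive polynomial ['X - r%:P]. *)
Lemma dev_le1_quotient : has_dev normals -> dev_le1 Qsub.
Proof.
move=> /has_dev_quotient; apply: dev_le1_submodules => r v.
exists ('X - r%:P); split.
  move=> q qpr; exists 1%N; rewrite coefB coefX coefC /= subr0.
  by rewrite dvdz1 /= gtn_eqF // prime_gt1.
by rewrite rmorphB /= map_polyX map_polyC /= !hornerE intz subrr scale0r.
Qed.

(** A normal subgroup is controlled by its intersection with [M] and its image modulo [M]: once both
    are stationary along a chain inside a factor, so is the chain. *)
Lemma dev_le1_extension : dev_le1 Usub -> dev_le1 Qsub -> dev_le1 normals.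
Proof.
have traceS (N N' : set G) : (N <= N')%O -> (trace N <= trace N')%O.
  by move=> /subsetPset NN'; apply/subsetPset => u /NN'.
have imageS (N N' : set G) : (N <= N')%O -> (quotient_image N <= quotient_image N')%O.
  by move=> /subsetPset NN'; apply/subsetPset => _ [g /NN' Ng <-]; exists g.
move=> dU dQ a [aN ad].
have [n1 n1P] : exists n : nat, forall i : nat, (n <= i)%N ->
    dcc (poset_factor Usub (trace (a i)) (trace (a i.+1))).
  by apply: dU; split=> i; [exact: submodule_trace (aN i)|exact: traceS].
have [n2 n2P] : exists n : nat, forall i : nat, (n <= i)%N ->
    dcc (poset_factor Qsub (quotient_image (a i)) (quotient_image (a i.+1))).
  by apply: dQ; split=> i; [exact: submodule_image (aN i)|exact: imageS].
exists (maxn n1 n2) => i; rewrite geq_max => /andP[/n1P dT /n2P dI] x [xN xd].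
have [j1 j1P] : exists n : nat, forall j : nat, (n <= j)%N -> trace (x j) = trace (x n).
  apply: dcc_stable dT _; split=> j; last exact: traceS.
  have [xn /andP[? ?]] := xN j; split; first exact: submodule_trace xn.
  by rewrite !traceS.
have [j2 j2P] : exists n : nat, forall j : nat, (n <= j)%N ->
    quotient_image (x j) = quotient_image (x n).
  apply: dcc_stable dI _; split=> j; last exact: imageS.
  have [xn /andP[? ?]] := xN j; split; first exact: submodule_image xn.
  by rewrite !imageS.
exists (maxn j1 j2); set j := maxn _ _.
have tE : trace (x j.+1) = trace (x j).
  by rewrite !j1P // ?leqW // leq_maxl.
have iE : quotient_image (x j.+1) = quotient_image (x j).
  by rewrite !j2P // ?leqW // leq_maxr.
have /subsetPset xs := xd j; apply/seteqP; split=> // g xg.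
(* Modular law: [g] differs from some [h] in [x j.+1] by an element of [M] lying in [x j], and
   therefore in [x j.+1]. *)
have [h xh] : quotient_image (x j.+1) (cls g) by rewrite iE; exists g.
move=> /(cls_eq M_normal B_abelian) Mhg; have xs1 := normal_sub (xN j.+1).1; have xs0 := normal_sub (xN j).1.
have : trace (x j.+1) (umk M_normal M_abelian B_abelian Mhg).
  rewrite tE; apply: (subgroupM xs0) => //; apply: (subgroupV xs0); exact: xs.
by rewrite /kernel_trace /= => /(subgroupM xs1 xh); rewrite mulVKg.
Qed.

Lemma conj_cls g h : cls g = cls h -> conj g = conj h.
Proof.
move=> /(cls_eq M_normal B_abelian) Mgh; rewrite -[h](mulVKg g) /conj oper_conjM (oper_conj1 _ _ _ Mgh).
by rewrite mul1r.
Qed.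

(** [finite_rank] yields a nonzero integer multiple of the class of [g] in the span of [s]; if the
    multiplier is negative, its opposite is taken. *)
Lemma finite_rank_quotient : has_dev normals ->
  exists s : seq Q, forall g, exists2 n : nat, (0 < n)%N &
    forall X : set (zmodule Q), submodule X -> {in s, forall q, X q} -> X (cls (g ^+ n)%g).
Proof.
move=> /has_dev_quotient/finite_rank[s sP]; exists s => g.
have clsX n : cls (g ^+ n)%g = cls g *+ n by exact: clsX.
have [g0|g0] := pselect (cls g = 0).
  by exists 1%N => // X Xs _; rewrite expg1 g0; exact: (submodule0 Xs).
have [[n|n] n0 sn] := sP (cls g : zmodule Q) g0.
  exists n; first by case: n n0 {sn} => //; rewrite scale0r.
  by move=> X Xs sX; rewrite clsX; apply: sn.
exists n.+1 => // X Xs sX; rewrite clsX.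
have := submoduleN Xs (sn X Xs sX); rewrite scalezrE NegzE mulrNz opprK.
exact.
Qed.

Hypothesis M_torsion_free : torsion_free M.

Lemma kernel_mulrn_eq0 (u : U) n : (0 < n)%N -> u *+ n = 0 -> u = 0.
Proof.
move=> n0 un; apply: uval_inj; apply: (M_torsion_free (uvalP u) n0).
by rewrite -uvalMn un.
Qed.

Lemma kernel_natr_eq0 (u : U) n : (0 < n)%N -> (n%:R : O) *: u = 0 -> u = 0.
Proof. by move=> n0; rewrite scaler_nat; apply: kernel_mulrn_eq0. Qed.

Lemma kernel_intr_eq0 (u : U) (n : int) : n != 0 -> (n%:~R : O) *: u = 0 -> u = 0.
Proof.
case: n => n n0; first by apply: kernel_natr_eq0; rewrite lt0n.
rewrite NegzE rmorphN scaleNr => /eqP; rewrite oppr_eq0 => /eqP.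
exact: kernel_natr_eq0.
Qed.

(** Algebraicity spreads from the generators [conj g] to all operators because integral elements
    form a ring; torsion-freeness then allows division by the content. *)
Lemma primitive_relation :
  (forall g (u : U), exists2 p : {poly int}, p != 0 & (map_poly intr p).[conj g] *: u = 0) ->
  forall (r : O) (u : U), exists p : {poly int},
    (forall q : nat, prime q -> exists i, ~~ (q %| p`_i)%Z) /\
    (map_poly intr p).[r] *: u = 0.
Proof.
move=> alg r u; have [->|u0] := eqVneq u 0.
  exists 1; split; last by rewrite scaler0.
  by move=> q qpr; exists 0%N; rewrite coef1 dvdz1 /= gtn_eqF // prime_gt1.
have [K [pi [_ piP]]] := annihilator_quotient u0.
have pi_int (n : int) : pi n%:~R = n%:~R by rewrite rmorph_int.
have intK_inj : injective (intr : int -> K).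
  apply: raddf_inj => n; rewrite -[LHS]pi_int => /piP E.
  by apply/eqP; apply: contraT => /kernel_intr_eq0/(_ E) u1; rewrite u1 eqxx in u0.
have pi_poly (p : {poly int}) s : pi (map_poly intr p).[s] = (map_poly intr p).[pi s].
  rewrite -horner_map -map_poly_comp; congr _.[_].
  by apply: eq_map_poly => n /=; rewrite rmorph_int.
(* For each generator a leading coefficient serves as [n]; differences and products multiply the
   denominators. *)
have [n n0 nr] : exists2 n : int, n != 0 & integralOver (intr : int -> K) (n%:~R * pi r).
  elim/oper_ind: r => [|g|r s [m m0 mr] [n n0 ns]|r s [m m0 mr] [n n0 ns]].
  - by exists 1; rewrite // mul1r rmorph1; apply: integral1.
  - have [p p0 pg] := alg g u; exists (lead_coef p); first by rewrite lead_coef_eq0.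
    apply: integral_lead_coef => //; apply/rootP.
    by rewrite -pi_poly; apply/piP.
  - exists (m * n); rewrite ?mulf_neq0// rmorphB rmorphM mulrBr.
    apply: integral_sub.
      by rewrite mulrAC mulrC; apply: integral_mul => //; apply: integral_id.
    by rewrite -mulrA; apply: integral_mul => //; apply: integral_id.
  - exists (m * n); rewrite ?mulf_neq0// !rmorphM /= mulrACA.
    exact: integral_mul.
have [p pm /rootP pr] := nr.
(* Substituting [n *: 'X] converts the monic relation for [n%:~R * pi r] into a relation for [r]. *)
pose g := p \Po (n *: 'X).
have g0 : g != 0.
  by rewrite /g comp_poly2_eq0 ?monic_neq0 // size_scale ?size_polyX.
have gr : (map_poly intr g).[r] *: u = 0.
  apply/piP; rewrite pi_poly -[RHS]pr /g map_comp_poly horner_comp; congr _.[_].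
  by rewrite map_polyZ map_polyX /= !hornerE.
exists (zprimitive g); split.
  move=> q qpr; apply: contrapT => /forallNP nq.
  have : (q %| zcontents (zprimitive g))%Z.
    by rewrite dvdz_contents; apply/polyOverP => i; apply: contrapT => /negP; apply: nq.
  by rewrite zcontents_primitive g0 dvdz1 /= gtn_eqF // prime_gt1.
have gc : zcontents g != 0 by rewrite zcontents_eq0.
apply: (kernel_intr_eq0 gc); rewrite scalerA -[RHS]gr {3}[g]zpolyEprim.
by rewrite map_polyZ /= hornerZ.
Qed.

Lemma krull_le1_of_algebraic : has_dev normals ->
  (forall g (u : U), exists2 p : {poly int}, p != 0 & (map_poly intr p).[conj g] *: u = 0) ->
  dev_le1 normals.
Proof.
move=> hd alg; apply: dev_le1_extension; last exact: dev_le1_quotient.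
by apply: dev_le1_submodules; [exact: primitive_relation|exact: has_dev_kernel].
Qed.

(* If [h] acts transcendentally on [u], the ring [K = O / ann u] has dimension at
   least two, while [K(G) <= 1] forces the artinian condition
   [b ^+ n \in b ^+ n.+1 K + q K] for every prime [q] and every [b]. *)
Lemma algebraic_of_krull_le1 : has_dev normals -> dev_le1 normals ->
  forall h (u : U), exists2 p : {poly int}, p != 0 & (map_poly intr p).[conj h] *: u = 0.
Proof.
move=> hd d1 h u; apply: contrapT => notalg.
have htr (p : {poly int}) : p != 0 -> (map_poly intr p).[conj h] *: u != 0.
  by move=> p0; apply/eqP => E; apply: notalg; exists p.
have u0 : u != 0.
  by have := htr 1 (oner_neq0 _); rewrite rmorph1 hornerC scale1r.
have [K [pi [pi_surj piP]]] := annihilator_quotient u0.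
have pi_poly (p : {poly int}) s : pi (map_poly intr p).[s] = (map_poly intr p).[pi s].
  rewrite -horner_map -map_poly_comp; congr _.[_].
  by apply: eq_map_poly => n /=; rewrite rmorph_int.
have [s sP] := finite_rank_quotient hd.
pose rep := @qrep G M M_normal B_abelian.
have repK q : cls (rep q) = q by exact: qrepK.
(* Inverses are listed too, so that the classes acting through [J] in both directions form a
   subgroup. *)
pose bs := [seq pi (conj (rep q)) | q <- s] ++ [seq pi (conj (rep q)^-1%g) | q <- s].
have [||q [b [qpr qb]]] := @not_one_dimensional K (pi (conj h)) bs.
- by move=> p /htr; rewrite -pi_poly; apply: contraNneq => /piP->.
- move=> J J1 JB JM Jroot Jbs x; have [r <-] := pi_surj x.
  elim/oper_ind: r => [|g|r t Jr Jt|r t Jr Jt]; rewrite ?rmorph1 ?rmorphB ?rmorphM; auto.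
  pose X : set (zmodule Q) := [set q | J (pi (conj (rep q))) /\ J (pi (conj (rep q)^-1%g))].
  have Xcls g' : X (cls g') <-> J (pi (conj g')) /\ J (pi (conj g'^-1%g)).
    have E := repK (cls g').
    have E' : cls (rep (cls g'))^-1%g = cls g'^-1%g by rewrite /cls !clsV; congr (- _).
    by rewrite /X /= (conj_cls E) (conj_cls E').
  have [n n0 nX] := sP g.
  have Xs : submodule X.
    apply: int_submodule.
    - rewrite -(cls1 M_normal B_abelian); apply/Xcls.
      by rewrite invg1 /conj oper_conj1 ?rmorph1 //; apply: subgroup1; apply: normal_sub.
    - move=> p q; rewrite -[p]repK -[q]repK /cls -clsM => /Xcls[? ?] /Xcls[? ?].
      by apply/Xcls; rewrite invgM /conj !oper_conjM !rmorphM; split; apply: JM.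
    - move=> p; rewrite -[p]repK /cls -clsV => /Xcls[? ?].
      by apply/Xcls; rewrite invgK.
  have /Xcls[Jn _] : X (cls (g ^+ n)%g).
    apply: nX => // p ps; split; apply: Jbs; rewrite mem_cat; apply/orP; [left|right];
    by apply/mapP; exists p.
  (* Only for a power of [g] does the span of [s] give membership; closure under roots descends to
     [g]. *)
  by apply: (Jroot _ n n0); rewrite -rmorphXn /= /conj -oper_conjX.
have [r rb] := pi_surj b.
have dU : dev_le1 Usub.
  by apply: dev_le1_embed d1; [move=> X; exact: normal_image|exact: kernel_image_mono].
pose a (i : nat) := cyclic ((q%:R ^+ i : O) *: u).
have as_ (i : nat) : submodule (a i) by exact: submodule_cyclic.
have aS (i : nat) : a i.+1 `<=` a i.
  by move=> _ [t _ <-]; exists (t * q%:R) => //; rewrite !scalerA -mulrA -exprS.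
have [i0 dF] : exists n : nat, forall i : nat, (n <= i)%N ->
    dcc (poset_factor Usub (a i) (a i.+1)).
  by apply: dU; split=> i; [exact: as_|apply/subsetPset].
(* These submodules descend inside one factor of the chain of multiples of [u] by powers of [q]; a
   repetition yields the relation that [qb] excludes, up to the factor [q ^ i0], which
   torsion-freeness cancels. *)
pose y (n : nat) := sum_set (cyclic ((q%:R ^+ i0 * r ^+ n) *: u)) (a i0.+1).
have [|n yE] := dF i0 (leqnn _) y.
  have ys n : submodule (y n) by apply: submodule_sum_set => //; apply: submodule_cyclic.
  split=> n; last first.
    apply/subsetPset; apply: sum_set_sub => //; last first.
      by apply: sum_setr; apply: submodule_cyclic.
    apply: subset_trans (sum_setl (as_ _)) => _ [t _ <-]; exists (t * r) => //.
    by rewrite !scalerA exprS; congr (_ *: _); ring.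
  split; first exact: ys. apply/andP; split; apply/subsetPset.
    by apply: sum_setr; apply: submodule_cyclic.
  apply: sum_set_sub => // _ [t _ <-]; exists (t * r ^+ n) => //.
  by rewrite !scalerA; congr (_ *: _); ring.
have : y n.+1 ((q%:R ^+ i0 * r ^+ n) *: u).
  by rewrite yE; apply: sum_setl => //; apply: cyclic_id.
move=> [_ [c _ <-] [_ [d _ <-] /esym/eqP]]; rewrite -subr_eq0 !scalerA -scalerDl -scalerBl.
set w := (X in X *: u) => /eqP wu.
have wE : w = (q ^ i0)%:R * (r ^+ n - (r ^+ n.+1 * c + q%:R * d)).
  rewrite /w natrX. by rewrite !exprS; ring.
have {wu}/piP : (r ^+ n - (r ^+ n.+1 * c + q%:R * d)) *: u = 0.
  have qi0 : (0 < q ^ i0)%N by rewrite expn_gt0 prime_gt0.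
  by apply: (kernel_natr_eq0 qi0); rewrite scalerA -wE.
rewrite rmorphB rmorphD !rmorphM !rmorphXn rmorph_nat /= rb => /eqP.
by rewrite subr_eq0 => /eqP; apply: qb.
Qed.

End KrullDimension.

(** * Sections isomorphic to the wreath product *)

Section Wreath.
Import GRing.Theory.
Local Open Scope ring_scope.
Local Notation W := Z_wr_Z.
(** Typing the coordinates as integers turns the multiplicative laws of both factors into ring
    notation. *)
Definition wb (w : W) : int -> int := wbase w.
Definition wt (w : W) : int := wtop w.

Lemma wbM v w i : wb (v * w)%g i = wb v i + wb w (i - wt v).
Proof. by rewrite [i - _]addrC. Qed.
Lemma wtM v w : wt (v * w)%g = wt v + wt w. Proof. by []. Qed.
Lemma wb1 i : wb 1%g i = 0. Proof. by []. Qed.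
Lemma wbV w i : wb w^-1%g i = - wb w (i + wt w).
Proof. by rewrite [i + _]addrC. Qed.
Lemma wtV w : wt w^-1%g = - wt w. Proof. by []. Qed.
Lemma w_eq v w : wb v =1 wb w -> wt v = wt w -> v = w.
Proof. by move=> vw tvw; exact: (@wreath_eq _ _ v w vw tvw). Qed.

End Wreath.

Section WreathSections.
Variables (G : groupType) (M : set G).
Hypotheses (M_normal : normal_subgroup M setT) (M_abelian : abelian_subgroup M)
  (B_abelian : abelian_quotient setT M).
Local Open Scope classical_set_scope.
Local Open Scope ring_scope.
Import GRing.Theory Num.Theory.

Let U := kernel_module M_normal M_abelian B_abelian.
Let O := operators_of M_normal M_abelian B_abelian.
Let conj : G -> O := oper_conj M_normal M_abelian B_abelian.

Local Notation uval := (@uval G M M_normal M_abelian B_abelian).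

Local Notation W := Z_wr_Z.

(** * A transcendental action embeds the wreath product *)

Section Embedding.
Variables (h : G) (u : U).
Hypothesis htr : forall p : {poly int}, p != 0 -> (map_poly intr p).[conj h] *: u != 0.

Definition zpow (j : int) : G :=
  match j with Posz n => (h ^+ n)%g | Negz n => (h ^- n.+1)%g end.

Lemma zpowS j : zpow (j + 1) = (zpow j * h)%g.
Proof.
case: j => n; first by rewrite -PoszD addn1 /= expgSr.
case: n => [|n].
  by rewrite (_ : Negz 0 + 1 = 0) //= mulVg.
rewrite (_ : Negz n.+1 + 1 = Negz n) /=; last by lia.
by rewrite (expgS h n.+1) invgM -mulgA mulVg mulg1.
Qed.

Lemma zpowP j : zpow (j - 1) = (zpow j * h^-1)%g.
Proof. by rewrite -[in RHS](subrK 1 j) zpowS mulgK. Qed.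

Lemma zpowD i j : zpow (i + j) = (zpow i * zpow j)%g.
Proof.
elim/int_rect: j => [|n IH|n IH]; first by rewrite addr0 mulg1.
  by rewrite -addn1 PoszD addrA !zpowS IH mulgA.
by rewrite -addn1 PoszD opprD addrA !zpowP IH mulgA.
Qed.

Lemma zpowN j : zpow (- j) = (zpow j)^-1%g.
Proof. by apply: (mulgI (zpow j)); rewrite -zpowD subrr mulgV. Qed.

Let A j : O := conj (zpow j).

Lemma conj_zpowD i j : A (i + j) = A i * A j.
Proof. by rewrite /A zpowD /conj oper_conjM mulrC. Qed.

Lemma conj_zpow_nat n : A (Posz n) = conj h ^+ n.
Proof. by rewrite /A /= /conj oper_conjX. Qed.

(** The Laurent polynomial with coefficients [f], evaluated at [conj h] and applied to [u]. *)
Definition laurent (f : int -> int) : U :=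
  \sum_(i \in [set: int]) (f i)%:~R *: (A i *: u).

Lemma laurentE (f : int -> int) r : uniq r -> (forall i, f i != 0 -> i \in r) ->
  laurent f = \sum_(i <- r) (f i)%:~R *: (A i *: u).
Proof.
move=> ur fr; rewrite /laurent (fsbigE r) //.
  by apply: eq_bigl => i; apply: mem_set.
move=> i _ ir; have -> : f i = 0 by apply/eqP; apply: contraNT ir; apply: fr.
by rewrite scale0r.
Qed.

Definition finsupp (f : int -> int) : Prop := finite_set [set i | f i <> 0].

Lemma finsupp_seq f : finsupp f -> exists2 r, uniq r & forall i, f i != 0 -> i \in r.
Proof.
move=> /finite_seqP[s sE]; exists (undup s); first exact: undup_uniq.
move=> i /eqP fi; rewrite mem_undup.
by have : [set` s] i by rewrite -sE.
Qed.

Lemma laurentD f g : finsupp f -> finsupp g ->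
  laurent (fun i => f i + g i) = laurent f + laurent g.
Proof.
move=> /finsupp_seq[r _ fr] /finsupp_seq[s _ gs].
have rs := undup_uniq (r ++ s).
rewrite !(@laurentE _ _ rs).
- by rewrite -big_split; apply: eq_bigr => i _; rewrite intrD scalerDl.
- by move=> i /gs; rewrite mem_undup mem_cat => ->; rewrite orbT.
- by move=> i /fr; rewrite mem_undup mem_cat => ->.
move=> i; rewrite mem_undup mem_cat; apply: contraR; rewrite negb_or => /andP[ir is_].
have /eqP -> : f i == 0 by apply: contraNT ir; apply: fr.
by have /eqP -> : g i == 0 by apply: contraNT is_; apply: gs.
Qed.

Lemma laurent_shift f t : finsupp f -> laurent (fun i => f (i - t)) = A t *: laurent f.
Proof.
move=> /finsupp_seq[r ur fr].
rewrite (@laurentE _ [seq i + t | i <- r]); first last.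
- by move=> i /fr ir; apply/mapP; exists (i - t); rewrite ?subrK.
- by rewrite map_inj_uniq //; apply: addIr.
rewrite (laurentE ur fr) big_map scaler_sumr; apply: eq_bigr => i _.
by rewrite addrK conj_zpowD !scalerA; congr (_ *: _); ring.
Qed.

(** With the support between [-N] and [N], multiplication by the [N]-th power of [conj h] leaves an
    ordinary polynomial, to which [htr] applies. *)
Lemma laurent_eq0 f : finsupp f -> laurent f = 0 -> forall i, f i = 0.
Proof.
move=> fs f0; have [r _ fr] := finsupp_seq fs.
pose N := \max_(i <- r) `|i|%N.
have fN i : f i != 0 -> (`|i| <= N)%N.
  by move=> /fr ir; apply: (@leq_bigmax_seq _ _ predT (fun i : int => `|i|%N)).
pose s := [seq Posz n - Posz N | n <- iota 0 (N + N).+1].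
have us : uniq s by rewrite map_inj_uniq ?iota_uniq // => m n /addIr [].
have fs' i : f i != 0 -> i \in s.
  move=> /fN iN; apply/mapP; exists `|(i + Posz N)%R|%N; last first.
    by rewrite gez0_abs ?addrK //; lia.
  by rewrite mem_iota; lia.
pose p := \poly_(n < (N + N).+1) f (Posz n - Posz N).
have pu : (map_poly intr p).[conj h] *: u = A (Posz N) *: laurent f.
  rewrite (laurentE us fs') big_map -[iota 0 _]/(index_iota 0 (N + N).+1) big_mkord.
  rewrite (@horner_coef_wide _ (N + N).+1); last first.
    exact: leq_trans (size_poly _ _) (size_poly _ _).
  rewrite scaler_suml scaler_sumr; apply: eq_bigr => i _.
  rewrite coef_map /= coef_poly ltn_ord !scalerA; congr (_ *: _).
  by rewrite mulrAC -conj_zpowD [Posz N + _]addrCA subrr addr0 conj_zpow_nat mulrC.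
rewrite f0 scaler0 in pu.
have p0 : p = 0 by apply/eqP; apply: contraT => /htr; rewrite pu eqxx.
move=> i; apply/eqP; apply: contraT => fi.
have := fs' i fi => /mapP[n]; rewrite mem_iota add0n => /andP[_ nN] iE.
have := congr1 (fun q : {poly int} => q`_n) p0; rewrite coef_poly nN coef0 -iE => fi0.
by rewrite fi0 eqxx in fi.
Qed.

Lemma finsupp_delta (j : int) : finsupp (fun i => (i == j)%:R).
Proof.
apply: (@sub_finite_set _ _ [set j]); last exact: finite_set1.
by move=> i /=; case: eqP.
Qed.

Lemma laurent_delta j : laurent (fun i => (i == j)%:R) = A j *: u.
Proof.
rewrite (@laurentE _ [:: j]) //; first by rewrite big_seq1 eqxx scale1r.
by move=> i; rewrite inE; case: (i == j).
Qed.

(** A power of [h] in [M] acts trivially, so the difference of the monomials of degrees [j] and 0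
    kills [u] and must be zero. *)
Lemma zpow_kernel j : M (zpow j) -> j = 0.
Proof.
move=> Mj; have Aj : A j = 1 by apply: oper_conj1.
have A0 : A 0 = 1 by apply: oper_conj1; apply: subgroup1; apply: normal_sub.
have fs : finsupp (fun i => - (i == 0)%:R).
  apply: (@sub_finite_set _ _ [set 0]); last exact: finite_set1.
  by move=> i /=; case: eqP.
pose f (i : int) : int := (i == j)%:R + - (i == 0)%:R.
have ffs : finsupp f.
  apply: (@sub_finite_set _ _ ([set j] `|` [set 0])).
    by move=> i /=; rewrite /f; case: eqP => [->|_]; [left|case: eqP => [->|_]; [right|]].
  by rewrite finite_setU; split; apply: finite_set1.
have L0 : laurent f = 0.
  have E : laurent (fun i => (i == 0)%:R + - (i == 0)%:R) = 0.
    by rewrite /laurent fsbig1 // => i _; rewrite subrr scale0r.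
  rewrite laurentD ?laurent_delta // in E; last exact: finsupp_delta.
  rewrite /f laurentD ?laurent_delta //; last exact: finsupp_delta.
  by rewrite Aj -A0.
have := laurent_eq0 ffs L0 j; rewrite /f eqxx.
by case: eqP => // _; rewrite oppr0 addr0.
Qed.

(** The sign on [wt w] reflects that conjugation is a right action: moving [zpow (- t)] to the right
    past an element of [M] conjugates that element by [zpow t]. *)
Definition wmap (w : W) : G := (uval (laurent (wb w)) * zpow (- wt w))%g.

Lemma wb_finsupp (w : W) : finsupp (wb w).
Proof. exact: wbase_finite w. Qed.

Lemma wmapM (v w : W) : wmap (v * w)%g = (wmap v * wmap w)%g.
Proof.
rewrite /wmap (_ : wb (v * w)%g = fun i => wb v i + wb w (i - wt v)); last first.
  by apply/funext => i; apply: wbM.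
rewrite laurentD; [|exact: wb_finsupp|]; last first.
  have := @finite_translate (Algebra.to_multiplicative int)
    (Algebra.to_multiplicative int) (wb w) (- wt v) (wb_finsupp w).
  apply: sub_finite_set => i /=; rewrite [i - _]addrC; exact.
rewrite laurent_shift; last exact: wb_finsupp.
rewrite uvalD uval_conj wtM opprD zpowD !mulgA; congr (_ * _)%g.
by rewrite zpowN mulgK.
Qed.

Lemma wmap1 : wmap 1%g = 1%g.
Proof. by apply: (mulgI (wmap 1%g)); rewrite -wmapM !mulg1. Qed.

Lemma wmapV w : wmap w^-1%g = (wmap w)^-1%g.
Proof. by apply: (mulgI (wmap w)); rewrite -wmapM !mulgV wmap1. Qed.

Lemma wmap_inj : injective wmap.
Proof.
suff ker w : wmap w = 1%g -> w = 1%g.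
  move=> v w E; apply: (mulgI v^-1%g); rewrite mulVg; apply/esym/ker.
  by rewrite wmapM wmapV E mulVg.
move=> /(canRL (mulgK _)); rewrite mul1g -zpowN opprK => E.
have wt0 : wt w = 0 by apply: zpow_kernel; rewrite -E; apply: uvalP.
apply: w_eq => // i; rewrite wb1; apply: (laurent_eq0 (wb_finsupp w)).
by apply: uval_inj; rewrite E wt0.
Qed.

Lemma has_section_wreath : has_section G Z_wr_Z.
Proof.
have lc1 g : lcoset [set 1%g] g = [set g].
  apply/seteqP; split=> x; first by move=> [_ -> <-] /=; rewrite mulg1.
  by move=> /= ->; exists 1%g => //; rewrite mulg1.
have Hs : subgroup (range wmap).
  apply: subgroup_intro; first by exists 1%g => //; apply: wmap1.
  by move=> _ _ [v _ <-] [w _ <-]; exists (v * w^-1)%g => //; rewrite wmapM wmapV.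
(* The cosets of the trivial subgroup in the image are singletons, on which [f] inverts [wmap];
   other sets go to 1. *)
have /choice[f fP] : forall C : set G, exists w : W, forall v, C = [set wmap v] -> w = v.
  move=> C; have [[v Cv]|nov] := pselect (exists v, C = [set wmap v]).
    exists v => w Cw; apply: wmap_inj.
    by have : C (wmap v) by [rewrite Cv]; rewrite Cw.
  by exists 1%g => v Cv; exfalso; apply: nov; exists v.
have fE w : f [set wmap w] = w by apply: fP.
exists (range wmap), [set 1%g]; split=> //.
  split.
  - by apply: subgroup_intro => // x y -> ->; rewrite mulgV.
  - by move=> x ->; exists 1%g => //; apply: wmap1.
  - by move=> x h' -> _ /=; rewrite conj1g.
exists f; first split.
- by [].
- move=> C D; rewrite !inE => -[_ [v _ <-] <-] [_ [w _ <-] <-].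
  by rewrite !lc1 !fE => ->.
- move=> w _; exists [set wmap w]; last exact: fE.
  by exists (wmap w); [exists w|rewrite lc1].
move=> _ _ [_ [v _ <-] <-] [_ [w _ <-] <-]; rewrite !lc1 !fE.
rewrite (_ : set_mul _ _ = [set wmap (v * w)%g]) ?fE //.
apply/seteqP; split=> x; first by move=> [_ -> [_ -> <-]] /=; rewrite wmapM.
by move=> /= ->; exists (wmap v) => //; exists (wmap w) => //; rewrite wmapM.
Qed.

End Embedding.

(** * A wreath section provides a transcendental action *)

Definition coefz (p : {poly int}) (j : int) : int := if j is Posz n then p`_n else 0.

Lemma coefz_mulXD (q : {poly int}) (c : int) j :
  coefz (q * 'X + c%:P) j = coefz q (j - 1) + c * (j == 0)%:R.
Proof.
case: j => [[|n]|n].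
- by rewrite /coefz coefD coefMX coefC /= mulr1.
- rewrite (_ : Posz n.+1 - 1 = n); last by lia.
  by rewrite /coefz coefD coefMX coefC /= mulr0.
- rewrite (_ : Negz n - 1 = Negz n.+1); last by lia.
  by rewrite /= mulr0 addr0.
Qed.

Fact delta_finite (j : int) : finite_set [set i : Algebra.to_multiplicative int |
  ((i == j)%:R : Algebra.to_multiplicative int) <> 1%g].
Proof. exact: finsupp_delta. Qed.

Fact zero_finite : finite_set [set i : Algebra.to_multiplicative int |
  (0 : Algebra.to_multiplicative int) <> 1%g].
Proof. by apply: sub_finite_set (finite_set0 _) => i /=; apply. Qed.

(* In [Z wr Z] the commutator of a generator of the base with a generator of
   the top has coordinates [1] at [-1] and [-1] at [0]; no nonzero polynomial
   in the top generator kills it. *)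
Lemma transcendental_of_section : has_section G Z_wr_Z ->
  exists (h : G) (u : U), forall p : {poly int}, p != 0 ->
    (map_poly intr p).[conj h] *: u != 0.
Proof.
move=> [H [K [Hs [Ks KH KJ] [f [fT finj fsurj] fM]]]].
pose F x : W := f (lcoset K x).
have HQ x : H x -> quotient H K (lcoset K x) by move=> Hx; exists x.
have FM x y : H x -> H y -> F (x * y)%g = (F x * F y)%g.
  move=> Hx Hy; rewrite /F -fM; try exact: HQ.
  congr f; apply/seteqP; split=> z.
    move=> [k Kk <-]; exists x; first by exists 1%g; [exact: subgroup1|rewrite mulg1].
    by exists (y * k)%g; [exists k|rewrite mulgA].
  move=> [_ [k Kk <-] [_ [k' Kk' <-] <-]]; exists (k ^ y * k')%g.
    by apply: subgroupM => //; apply: KJ.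
  by rewrite conjgE !mulgA mulgK.
have Fsurj w : exists2 x, H x & F x = w.
  by have [C [x Hx <-] <-] := fsurj w I; exists x.
have F1 : F 1%g = 1%g.
  by apply: (mulgI (F 1%g)); rewrite -FM ?mulg1 //; apply: subgroup1.
have FV x : H x -> F x^-1%g = (F x)^-1%g.
  move=> Hx; apply: (mulgI (F x)); rewrite -FM ?mulgV //; exact: subgroupV.
pose t : W := Wreath ((1 : int) : Algebra.to_multiplicative int) zero_finite.
pose e : W := Wreath (0 : Algebra.to_multiplicative int) (delta_finite 0).
have wbt i : wb t i = 0 by reflexivity.
have wtt : wt t = 1 by reflexivity.
have wbe i : wb e i = (i == 0)%:R by reflexivity.
have wte : wt e = 0 by reflexivity.
have [h Hh Fh] := Fsurj t; have [y Hy Fy] := Fsurj e.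
(* The preimage [y] of a base generator need not lie in [M], but its commutator with [h] does. *)
have Mm : M (y^-1 * y ^ h)%g.
  apply/(cls_eq M_normal B_abelian); rewrite conjgE clsC -mulgA mulgV mulg1.
  by [].
pose u : U := umk M_normal M_abelian B_abelian Mm.
pose b (v : U) (i : int) : int := wb (F (uval v)) i.
(* The part of [M] inside [H] that maps to the base group; the coordinates [b] are additive
   there. *)
pose D (v : U) := H (uval v) /\ wt (F (uval v)) = 0.
have bD v w i : D v -> D w -> b (v + w) i = b v i + b w i.
  by move=> [Hv tv] [Hw tw]; rewrite /b uvalD FM // wbM tv subr0.
have DD v w : D v -> D w -> D (v + w).
  move=> [Hv tv] [Hw tw]; split; rewrite uvalD; first exact: subgroupM.
  by rewrite FM // wtM tv tw.
have DN v : D v -> D (- v).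
  move=> [Hv tv]; split; rewrite uvalN; first exact: subgroupV.
  by rewrite FV // wtV tv.
have D0 : D 0 by split; rewrite uval0; [exact: subgroup1|rewrite F1].
have b0 i : b 0 i = 0 by rewrite /b uval0 F1.
have bN v i : D v -> b (- v) i = - b v i.
  by move=> Dv; apply/eqP; rewrite -addr_eq0 -bD ?addNr ?b0 //; apply: DN.
have bZ v (c : int) i : D v -> D ((c%:~R : O) *: v) /\ b ((c%:~R : O) *: v) i = c * b v i.
  move=> Dv; elim/int_rect: c => [|n [Dn IH]|n [Dn IH]].
  - by rewrite scale0r mul0r.
  - by rewrite -addn1 PoszD rmorphD scalerDl scale1r mulrDl mul1r bD ?IH //; split; [apply: DD|].
  - rewrite -addn1 PoszD opprD rmorphB scalerBl scale1r mulrBl mul1r bD //; last exact: DN.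
    by rewrite bN // IH; split=> //; apply: DD => //; apply: DN.
have bconj v i : D v -> D (conj h *: v) /\ b (conj h *: v) i = b v (i + 1).
  move=> [Hv tv]; have HVh := subgroupV Hs Hh.
  have E : F (uval (conj h *: v)) = (t^-1 * (F (uval v) * t))%g.
    by rewrite uval_conj conjgE !FM ?FV ?Fh //; apply: subgroupM.
  split; first split.
  - by rewrite uval_conj conjgE; do 2?apply: subgroupM => //.
  - by rewrite E !wtM wtV tv; lia.
    by rewrite /b E !wbM wbV wtV !wbt wtt opprK oppr0 add0r addr0.
have bu i : D u /\ b u i = (i + 1 == 0)%:R - (i == 0)%:R.
  have E : F (uval u) = (e^-1 * (t^-1 * (e * t)))%g.
    rewrite /= conjgE !FM ?FV ?Fh ?Fy //; do ?[exact: subgroupV|apply: subgroupM => //].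
  split; first split.
  - by rewrite /= conjgE; do ?[exact: subgroupV|apply: subgroupM => //].
  - by rewrite E !wtM !wtV; lia.
  - rewrite /b E !(wbM, wbV, wtV) !wbt !wbe wtt wte.
    by rewrite !opprK !(subr0, addr0, oppr0, add0r) addrC.
exists h, u => p p0; apply/eqP => pu.
(* Acting by [conj h] shifts coordinates by one, so a polynomial applied to [u] shows the
   differences of its consecutive coefficients. *)
have bp (q : {poly int}) : D ((map_poly intr q).[conj h] *: u) /\
    forall i, b ((map_poly intr q).[conj h] *: u) i = coefz q (- i - 1) - coefz q (- i).
  elim/poly_ind: q => [|q c [Dq IH]].
    rewrite rmorph0 horner0 scale0r; split=> // i; rewrite b0.
    by rewrite /coefz; case: (_ - 1) => n; case: (- i) => m; rewrite ?coef0 subrr.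
  rewrite rmorphD rmorphM /= map_polyX map_polyC /= !hornerE scalerDl mulrC -scalerA.
  have [Dh bh] := bconj _ 0 Dq; have [Dc _] := bZ u c 0 (bu 0).1.
  split=> [|i]; first exact: DD.
  rewrite bD // (bconj _ _ Dq).2 IH (bZ u c _ (bu 0).1).2 (bu i).2 !coefz_mulXD.
  have -> : - (i + 1) - 1 = - i - 1 - 1 by lia.
  have -> : - (i + 1) = - i - 1 by lia.
  have -> : (- i - 1 == 0) = (i + 1 == 0) by apply/eqP/eqP; lia.
  by rewrite oppr_eq0 mulrBr opprD addrACA.
(* If [p] kills [u], consecutive coefficients agree; being 0 at negative indices, they are all 0. *)
have pE (i : int) : coefz p (i - 1) = coefz p i.
  apply/eqP; rewrite -subr_eq0 -{1 2}[i]opprK; apply/eqP.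
  by rewrite -(bp p).2 pu b0.
move: p0; apply/negP; rewrite negbK; apply/eqP/polyP => n; rewrite coef0.
rewrite -[p`_n]/(coefz p n); elim: n => [|n IH]; first by rewrite -pE.
by rewrite -pE -addn1 PoszD addrK.
Qed.

End WreathSections.

Theorem theorem3p4 (G : groupType) (M : set G) (k : xord)
  (G_metabelian : metabelian G)
  (M_normal : normal_subgroup M setT)
  (M_abelian : abelian_subgroup M)
  (M_torsion_free : torsion_free M)
  (B_abelian : abelian_quotient setT M)
  (K_G : krull_dim G k) :
  xle k (Some oone) <-> ~ has_section G Z_wr_Z.
Proof.
have hd := dev_has_dev K_G.
split=> [k1|nosec].
  move=> /(transcendental_of_section M_normal M_abelian B_abelian)[h [u htr]].
  have [p p0 pu] := algebraic_of_krull_le1 M_torsion_free hd (dev_dev_le1 K_G k1) h u.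
  by have := htr p p0; rewrite pu eqxx.
apply: (dev_le1_xle K_G); apply: (krull_le1_of_algebraic M_torsion_free hd) => h u.
apply: contrapT => notalg; apply: nosec; apply: (has_section_wreath (h := h) (u := u)).
by move=> p p0; apply/eqP => pu; apply: notalg; exists p.
Qed.
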